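(* Consider the additive error setting described in the context, with $q\in[0,1]$ fixed. Suppose that, for a universal constant $c_1$, the matrix $\hat\Gamma=\frac{Z^\top Z}{m}-\sigma_w^2 I_n$ satisfies the restricted eigenvalue condition $$\beta^\top\hat\Gamma\beta\ \ge\ \kappa_l\|\beta\|_2^2-\tau_l(R_q,m,n)\qquad\text{for all }\beta\in\mathbb{B}_q(2R_q),$$ with $\kappa_l>0$ and $\tau_l(R_q,m,n)\le c_1R_q\left(\frac{\log n}{m}\right)^{1-q/2}$. Then there exist universal constants $c_2,c_3>0$ and a constant $c_q>0$ depending only on $q$ such that, with probability at least $1-c_2\exp(-c_3\log n)$, the minimax $\ell_2$-loss over the $\ell_q$-ball is bounded above as $$\min_{\hat\beta}\max_{\beta^*\in\mathbb{B}_q(R_q)\cap\mathbb{B}_2(1)}\|\hat\beta-\beta^*\|_2^2\ \le\ c_q\left[\frac{\sigma_z^{2-q}(\sigma_w+\sigma_\epsilon)^{2-q}+\kappa_l^{1-q}}{\kappa_l^{2-q}}\right]R_q\left(\frac{\log n}{m}\right)^{1-q/2}.$$ That is, denoting the right-hand side by $\rho$, there is an estimator $\hat\beta$ (a measurable function of the observed data $(y,Z)$ with values in $\mathbb{R}^n$) such that for every $\beta^*\in\mathbb{B}_q(R_q)\cap\mathbb{B}_2(1)$, when the data are generated with parameter $\beta^*$, the probability (over $(y,Z)$) that $\hat\Gamma$ satisfies the restricted eigenvalue condition $\beta^\top\hat\Gamma\beta\ge\kappa_l\|\beta\|_2^2-\tau_l(R_q,m,n)$ for all $\beta\in\mathbb{B}_q(2R_q)$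 and yet $\|\hat\beta(y,Z)-\beta^*\|_2^2>\rho$ is at most $c_2\exp(-c_3\log n)$.
   Context: Additive error setting: $m,n\ge 1$ are integers. For $i=1,\dots,m$, $y_i=\langle\beta^*,X_{i\cdot}\rangle+e_i$ with unknown $\beta^*\in\mathbb{R}^n$, and one observes $(Z_{i\cdot},y_i)$ where $Z_{i\cdot}=X_{i\cdot}+W_{i\cdot}$. The vectors $X_{i\cdot}\sim\mathcal{N}(0,\sigma_x^2 I_n)$ and $W_{i\cdot}\sim\mathcal{N}(0,\sigma_w^2 I_n)$ and the scalars $e_i\sim\mathcal{N}(0,\sigma_\epsilon^2)$ are mutually independent, and i.i.d. over $i$; the covariance $\sigma_w^2I_n$ is known. Write $\sigma_z^2=\sigma_x^2+\sigma_w^2$ (with $\sigma_x,\sigma_w,\sigma_z,\sigma_\epsilon\ge0$). $Z\in\mathbb{R}^{m\times n}$ is the matrix with rows $Z_{i\cdot}$ and $y=(y_1,\dots,y_m)^\top$. For $q\in[0,1]$ and $R>0$, $\mathbb{B}_q(R)=\{\beta\in\mathbb{R}^n:\|\beta\|_q^q=\sum_{j=1}^n|\beta_j|^q\le R\}$, where for $q=0$ the sum is the number of nonzero entries of $\beta$ (i.e. $0^0=0$); $R_q>0$ is a given radius. $\mathbb{B}_2(1)=\{\beta\in\mathbb{R}^n:\|\beta\|_2=1\}$ (the unit sphere). ''Universal constant'' means a numerical constant not depending on $m,n,R_q,\kappa_l,\sigma_x,\sigma_w,\sigma_\epsilon$ or $q$; $c_1$ is such a constant, fixed in advance. *)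

(* Defs.v *)
From HB Require Import structures.
From mathcomp Require Import all_boot all_order all_algebra.
From mathcomp Require Import all_classical all_reals all_analysis.

Set Implicit Arguments.
Unset Strict Implicit.
Unset Printing Implicit Defensive.

Import Order.TTheory GRing.Theory Num.Theory.
Import numFieldNormedType.Exports.

Local Open Scope classical_set_scope.
Local Open Scope ring_scope.

(* Matrices carry the product sigma-algebra, i.e. the one generated by the
   entries; for entries in R this is the Borel sigma-algebra. *)
Section measurable_matrix.
Context {d : measure_display} {T : measurableType d}.
Variables m n : nat.

Definition mx_cylinder : set (set 'M[T]_(m, n)) :=
  [set A | exists i j,
     preimage_set_system setT (fun M : 'M[T]_(m, n) => M i j) measurable A].

Let mx0 : <<s mx_cylinder >> set0.
Proof. exact: sigma_algebra0. Qed.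

Let mxC A : <<s mx_cylinder >> A -> <<s mx_cylinder >> (~` A).
Proof. exact: sigma_algebraC. Qed.

Let mx_bigcup (F : (set 'M[T]_(m, n))^nat) :
  (forall i, <<s mx_cylinder >> (F i)) -> <<s mx_cylinder >> (\bigcup_i F i).
Proof. exact: sigma_algebra_bigcup. Qed.

HB.instance Definition _ := @isMeasurable.Build (measure_tuple_display d)
  'M[T]_(m, n) <<s mx_cylinder >> mx0 mxC mx_bigcup.

End measurable_matrix.

Section probability.
Context {R : realType} {d : measure_display} {T : measurableType d}.

(* The law N(0, s^2), s being the standard deviation. [normal_prob 0 0] is the
   uniform law on [0, 1], so the degenerate case has to be treated apart. *)
Definition centered_normal (s : R) (A : set R) : \bar R :=
  if s == 0 then \d_(0 : R) A else normal_prob 0 s A.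

Definition centered_normal_rv (P : probability T R) (s : R)
    (X : {RV P >-> R}) : Prop :=
  forall A : set R, measurable A -> distribution P X A = centered_normal s A.

(* X ~ N(0, s^2 I_n), whose law is the n-fold product of N(0, s^2); a finite
   product measure is determined by its values on measurable boxes. *)
Definition centered_normal_rvec (P : probability T R) (n : nat) (s : R)
    (X : {RV P >-> 'rV[R]_n}) : Prop :=
  forall A : 'I_n -> set R, (forall j, measurable (A j)) ->
    distribution P X [set x : 'rV[R]_n | forall j, A j (x 0 j)] =
    (\prod_(j < n) centered_normal s (A j))%E.

Definition mutually_independent (P : probability T R) (I : finType)
    (F : I -> set (set T)) : Prop :=
  forall (J : {set I}) (E : I -> set T), (forall i, i \in J -> F i (E i)) ->
    P (\bigcap_(i in [set` J]) E i) = (\prod_(i in J) P (E i))%E.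

Definition additive_error_setting (P : probability T R) (m n : nat)
    (sigma_x sigma_w sigma_eps : R) (X W : 'I_m -> {RV P >-> 'rV[R]_n})
    (e : 'I_m -> {RV P >-> R}) : Prop :=
  [/\ forall i, centered_normal_rvec sigma_x (X i),
      forall i, centered_normal_rvec sigma_w (W i),
      forall i, centered_normal_rv sigma_eps (e i) &
      mutually_independent P (fun k : 'I_m + 'I_m + 'I_m =>
        match k with
        | inl (inl i) => g_sigma_algebra_preimage (X i)
        | inl (inr i) => g_sigma_algebra_preimage (W i)
        | inr i => g_sigma_algebra_preimage (e i)
        end)].

Definition observed_Z (P : probability T R) (m n : nat)
    (X W : 'I_m -> {RV P >-> 'rV[R]_n}) (t : T) : 'M[R]_(m, n) :=
  \matrix_(i < m) (X i t + W i t).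

Definition observed_y (P : probability T R) (m n : nat) (beta : 'cV[R]_n)
    (X : 'I_m -> {RV P >-> 'rV[R]_n}) (e : 'I_m -> {RV P >-> R}) (t : T) :
    'cV[R]_m :=
  \col_(i < m) ((X i t *m beta) 0 0 + e i t).

End probability.

Section deterministic.
Context {R : realType}.

Definition l2norm (n : nat) (b : 'cV[R]_n) : R :=
  Num.sqrt (\sum_(j < n) b j 0 ^+ 2).

Definition l2sphere (n : nat) : set 'cV[R]_n := [set b | l2norm b = 1].

(* The test b j 0 == 0 enforces the convention 0^0 = 0, so that q = 0 counts
   the nonzero entries (whereas 0 `^ 0 = 1). *)
Definition lq_ball (n : nat) (q r : R) : set 'cV[R]_n :=
  [set b | \sum_(j < n) (if b j 0 == 0 then 0 else `|b j 0| `^ q) <= r].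

Definition Gamma_hat (m n : nat) (sigma_w : R) (Z : 'M[R]_(m, n)) : 'M[R]_n :=
  m%:R^-1 *: (Z^T *m Z) - (sigma_w ^+ 2)%:M.

Definition restricted_eigenvalue (n : nat) (q r kappa tau : R)
    (Gamma : 'M[R]_n) : Prop :=
  forall b : 'cV[R]_n, lq_ball q r b ->
    kappa * l2norm b ^+ 2 - tau <= (b^T *m Gamma *m b) 0 0.

End deterministic.

Arguments l2sphere {R} n.
Arguments lq_ball {R} n q r.

(* Main.v *)
Require Import Defs.
From mathcomp Require Import all_boot all_order all_algebra.
From mathcomp Require Import all_classical all_reals all_analysis.
From mathcomp Require Import measurable_realfun ring lra.
Import Order.TTheory GRing.Theory Num.Theory.
Import numFieldNormedType.Exports.
Local Open Scope classical_set_scope.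
Local Open Scope ring_scope.

(** Put xi = y - Z beta^* = e - W beta^*. The estimator minimises |y - Z b|^2 over
    B_q(R_q) and the unit sphere, where the bias correction sigma_w^2 |b|^2 is
    constant; it is the first near-minimiser in a countable dense subset, hence
    measurable. With D = beta_hat - beta^*, the basic inequality reads
    D^T Gamma_hat D <= 2 <Z^T xi / m + sigma_w^2 beta^*, D> + eps, and the vector on
    the right is centred because |D|^2 = -2 <beta^*, D>. If log n < m, its entries
    are O(sigma_z sigma_xi sqrt (log n / m)) with high probability: by polarisation
    they are differences of sums of squares of independent Gaussians, whose moment
    generating functions are computed by integrating out one variable at a time.
    Splitting |D_j| at the level lambda / kappa_l yields the rate. If log n >= m, the
    cruder bound |Z D|^2 <= 4 |xi|^2 + 2 m eps suffices, since |D| <= 2 and, by the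
    restricted eigenvalue condition on the unit vectors, kappa_l = O(sigma_z^2)
    unless the right-hand side exceeds 4. *)

(** * Gaussian integrals of exponentials of squares *)

Section normal_integral.
Context {R : realType}.
Implicit Types (m s x y a th : R).
Local Notation mu := (@lebesgue_measure R).

(** The Radon-Nikodym derivative and the density agree almost everywhere, since they have the same
    integral over every measurable set. *)
Lemma ge0_integral_normal_prob m s (f : R -> \bar R) :
  measurable_fun setT f -> (forall x, (0 <= f x)%E) ->
  (\int[normal_prob m s]_x f x = \int[mu]_x (f x * (normal_pdf m s x)%:E))%E.
Proof.
move=> mf f0.
have dom := normal_prob_dominates m s.
rewrite -(Radon_Nikodym_SigmaFinite.change_of_variables dom f0 measurableT mf).
have mg := measurable_int _ (Radon_Nikodym_SigmaFinite.f_integrable dom).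
have mpdf : measurable_fun setT (fun x => (normal_pdf m s x)%:E).
  by apply/measurable_EFinP; exact: measurable_normal_pdf.
apply: ae_eq_integral => //; try exact: emeasurable_funM.
apply: ae_eqe_mul2l; apply: integral_ae_eq => //.
- exact: Radon_Nikodym_SigmaFinite.f_integrable.
- by move=> E _ mE; rewrite -Radon_Nikodym_SigmaFinite.f_integral.
Qed.

(** Bundling the law as a probability measure gives access to product measures and Fubini-Tonelli,
    also when [s = 0]. *)
Definition cnormal s : probability (measurableTypeR R) R :=
  if s == 0 then [the probability _ _ of \d_(0 : measurableTypeR R)]
  else [the probability _ _ of normal_prob 0 s].

Lemma cnormalE s A : cnormal s A = centered_normal s A.
Proof. by rewrite /cnormal /centered_normal; case: ifP. Qed.

(* The expectation of [expR (th * (U + y) ^+ 2)] when U ~ N(0, v). *)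
Definition sqr_mgf v th y : R :=
  (Num.sqrt (1 - 2 * th * v))^-1 * expR (th * y ^+ 2 / (1 - 2 * th * v)).

Lemma sqr_mgf_ge0 v th y : 0 <= sqr_mgf v th y.
Proof. by rewrite mulr_ge0 ?invr_ge0 ?sqrtr_ge0 ?expR_ge0. Qed.

Lemma sqr_mgf0 th y : sqr_mgf 0 th y = expR (th * y ^+ 2).
Proof. by rewrite /sqr_mgf mulr0 subr0 sqrtr1 invr1 mul1r mulr1. Qed.

Lemma measurable_expR_sqr a y th :
  measurable_fun [set: R] (fun x => expR (th * (a * x + y) ^+ 2)).
Proof.
apply: measurableT_comp => //; apply: measurable_funM => //.
by apply: measurable_funX; apply: measurable_funD => //; exact: measurable_funM.
Qed.

(** Completing the square turns the integrand times the density into a constant times another normal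
    density. Negative [th] is allowed; it will give lower tails. *)
Lemma integral_normal_expR_sqr s a y th : 2 * th * (a ^+ 2 * s ^+ 2) < 1 ->
  (\int[cnormal s]_x (expR (th * (a * x + y) ^+ 2))%:E =
   (sqr_mgf (a ^+ 2 * s ^+ 2) th y)%:E)%E.
Proof.
move=> lt1; rewrite /cnormal; case: eqVneq => [->|s0].
  rewrite integral_dirac//=; last first.
    by apply/measurable_EFinP; exact: measurable_expR_sqr.
  by rewrite diracE in_setT mul1e mulr0 add0r expr0n/= mulr0 sqr_mgf0.
rewrite ge0_integral_normal_prob; last 2 first.
- by apply/measurable_EFinP; exact: measurable_expR_sqr.
- by move=> x; rewrite lee_fin expR_ge0.
set D := 1 - 2 * th * (a ^+ 2 * s ^+ 2).
have D0 : 0 < D by rewrite subr_gt0.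
have sD0 : Num.sqrt D != 0 by rewrite gt_eqF// sqrtr_gt0.
(* Mean and standard deviation of the exponentially tilted normal law. *)
pose m' := 2 * th * a * y * s ^+ 2 / D; pose s' := s / Num.sqrt D.
have s'0 : s' != 0 by rewrite mulf_neq0// invr_eq0.
have s'2 : s' ^+ 2 = s ^+ 2 / D by rewrite exprMn exprVn sqr_sqrtr// ltW.
transitivity (\int[mu]_x ((sqr_mgf (a ^+ 2 * s ^+ 2) th y)%:E *
    (normal_pdf m' s' x)%:E))%E; last first.
  rewrite ge0_integralZl_EFin ?integral_normal_pdf ?mule1//.
  - by move=> x _; rewrite lee_fin normal_pdf_ge0.
  - by apply/measurable_EFinP; exact: measurable_normal_pdf.
  - exact: sqr_mgf_ge0.
apply: eq_integral => x _; rewrite -!EFinM; congr EFin.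
rewrite !normal_pdfE// /normal_peak /normal_fun /sqr_mgf -/D s'2.
have -> : s ^+ 2 / D * pi *+ 2 = (s ^+ 2 * pi *+ 2) / D.
  by rewrite -[LHS]mulr_natr -[in RHS]mulr_natr; ring.
rewrite sqrtrM; last by rewrite mulrn_wge0// mulr_ge0 ?sqr_ge0 ?pi_ge0.
rewrite sqrtrV ?(ltW D0)//.
have P0 : Num.sqrt (s ^+ 2 * pi *+ 2) != 0.
  by rewrite gt_eqF// sqrtr_gt0 mulrn_wgt0// mulr_gt0 ?pi_gt0// exprn_even_gt0.
have -> : expR (th * (a * x + y) ^+ 2) * ((Num.sqrt (s ^+ 2 * pi *+ 2))^-1 *
    expR (- (x - 0) ^+ 2 / (s ^+ 2 *+ 2))) = (Num.sqrt (s ^+ 2 * pi *+ 2))^-1 *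
    (expR (th * y ^+ 2 / D) * expR (- (x - m') ^+ 2 / (s ^+ 2 / D *+ 2))).
  rewrite mulrCA -!expRD; congr (_ * expR _); rewrite /m' /D; field.
  by rewrite exprMn s0 -/D gt_eqF.
by field; rewrite P0 sD0.
Qed.

End normal_integral.

(** * Independent normal variables *)

Section independent_normals.
Context {R : realType} {d : measure_display} {T : measurableType d}.
Context (P : probability T R) {K : finType} (sg : K -> R) (g : K -> T -> R).

(** Boxes over all of [K] suffice: a factor [setT] drops a variable. *)
Definition independent_normals : Prop :=
  (forall k, measurable_fun setT (g k)) /\
  forall A : K -> set R, (forall k, measurable (A k)) ->
    P [set t | forall k, A k (g k t)] = (\prod_k cnormal (sg k) (A k))%E.

(** A pi-system generating the sigma-algebra of all the variables except [g k0]. *)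
Definition boxes_without (k0 : K) : set (set T) :=
  [set B | exists A : K -> set R, [/\ forall k, measurable (A k),
    A k0 = setT & B = [set t | forall k, A k (g k t)]]].

(** The space [T] with this coarser sigma-algebra, so that measurability on it expresses dependence
    on the other variables only. *)
Definition others_type (k0 : K) := g_sigma_algebraType (boxes_without k0).

Hypothesis ind : independent_normals.

Lemma measurable_box (A : K -> set R) : (forall k, measurable (A k)) ->
  measurable [set t | forall k, A k (g k t)].
Proof.
move=> mA; rewrite [X in measurable X](_ : _ =
    \bigcap_(k in [set` enum K]) (g k @^-1` A k)); last first.
  by apply/seteqP; split=> [t h k _|t h k]; [exact: h|apply: h; rewrite /= mem_enum].
rewrite bigcap_seq; apply: bigsetI_measurable => k _.
by rewrite -[X in measurable X]setTI; exact: ind.1.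
Qed.

Lemma boxes_without_measurable k0 : boxes_without k0 `<=` measurable.
Proof. by move=> _ [A [mA _ ->]]; exact: measurable_box. Qed.

(** Both sides are finite measures in [B] which agree on the pi-system [boxes_without k0], hence on
    the sigma-algebra it generates. *)
Lemma independent_others k0 (A : set R) (B : set T) : measurable A ->
  <<s boxes_without k0 >> B ->
  P (g k0 @^-1` A `&` B) = (cnormal (sg k0) A * P B)%E.
Proof.
move=> mA sB.
have mgA : measurable (g k0 @^-1` A).
  by rewrite -[X in measurable X]setTI; exact: ind.1.
have c0 : 0 <= fine (cnormal (sg k0) A) by rewrite fine_ge0.
have cE : (fine (cnormal (sg k0) A))%:E = cnormal (sg k0) A.
  by rewrite fineK// fin_num_measure.
have sE X : mscale (NngNum c0) P X = (cnormal (sg k0) A * P X)%E.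
  by transitivity ((fine (cnormal (sg k0) A))%:E * P X)%E => //; rewrite cE.
rewrite setIC -sE -[LHS]/(mrestr P mgA B).
apply: (g_sigma_algebra_measure_unique (boxes_without k0) _ (fun=> setT)) => //.
- exact: boxes_without_measurable.
- by move=> _; exists (fun=> setT); split=> //; apply/seteqP; split.
- by rewrite bigcup_const.
- move=> _ _ [A1 [mA1 A1T ->]] [A2 [mA2 A2T ->]].
  exists (fun k => A1 k `&` A2 k); split.
  + by move=> k; exact: measurableI.
  + by rewrite A1T A2T setIT.
  + by apply/seteqP; split=> [t [h1 h2] k|t h]; [split|split=> k; case: (h k)].
- move=> _ [A1 [mA1 A1T ->]]; apply: (etrans _ (esym (sE _))).
  rewrite -[LHS]/(P ([set t | forall k, A1 k (g k t)] `&` g k0 @^-1` A)) setIC.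
  rewrite ind.2// (bigD1 k0)//=.
  rewrite A1T probability_setT mul1e.
  (* As [A1 k0] is [setT], intersecting with the event on [g k0] fills the slot [k0] of the box. *)
  rewrite [X in P X](_ : _ =
    [set t | forall k, (if k == k0 then A else A1 k) (g k t)]); last first.
    apply/seteqP; split=> [t [h1 h2] k|t h].
      by case: eqP => [->//|_]; exact: h2.
    split=> [|k]; first by have := h k0; rewrite eqxx.
    by have := h k; case: eqP => [->|//]; rewrite A1T.
  rewrite (ind.2 (fun k => if k == k0 then A else A1 k)); last first.
    by move=> k; case: ifP.
  rewrite (bigD1 k0)//= eqxx; congr (_ * _)%E.
  by apply: eq_bigr => k /negbTE ->.
- by move=> _; rewrite -[ltLHS]/(P (setT `&` g k0 @^-1` A)) setTI (le_lt_trans (probability_le1 _ _))// ltry.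
Qed.

Lemma measurable_to_others k0 : measurable_fun setT (id : T -> others_type k0).
Proof.
move=> _ B mB; rewrite setTI preimage_id.
by move: B mB; apply: smallest_sub; [exact: sigma_algebra_measurable|exact: boxes_without_measurable].
Qed.

Lemma measurable_others k0 k : k != k0 ->
  measurable_fun [set: others_type k0] (g k).
Proof.
move=> kk0 _ B mB; rewrite setTI; apply: sub_sigma_algebra.
exists (fun l => if l == k then B else setT); split.
- by move=> l; case: ifP.
- by rewrite eq_sym (negbTE kk0).
- apply/seteqP; split=> t /=; first by move=> Bt l; case: eqP => [->|].
  by move/(_ k); rewrite eqxx.
Qed.

(** By independence the joint law of [g k0] and the identity into [others_type] is a product
    measure, and Fubini-Tonelli integrates out [g k0] alone. The point [t] stands for all the other
    variables. *)
Lemma integral_independent k0 (F : measurableTypeR R * others_type k0 -> \bar R) :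
  measurable_fun setT F -> (forall z, 0 <= F z)%E ->
  (\int[P]_t F (g k0 t, t) = \int[P]_t \int[cnormal (sg k0)]_x F (x, t))%E.
Proof.
move=> mF F0.
pose h (t : T) : measurableTypeR R * others_type k0 := (g k0 t, t).
have mh : measurable_fun setT h.
  by apply: measurable_fun_pair; [exact: ind.1|exact: measurable_to_others].
pose hM := [the {mfun _ >-> _} of mfun_Sub (mem_set mh)].
pose iM : {mfun T >-> others_type k0} :=
  mfun_Sub (mem_set (measurable_to_others k0)).
transitivity (\int[cnormal (sg k0) \x distribution P iM]_z F z)%E.
  rewrite -[LHS]/(\int[P]_t (F \o hM) t)%E -ge0_integral_distribution//.
  apply: eq_measure_integral => A mA _; apply/esym.
  apply: product_measure_unique => // A1 A2 mA1 mA2.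
  by rewrite -[RHS]independent_others.
rewrite fubini_tonelli2//= ge0_integral_distribution//.
- exact: measurable_fun_fubini_tonelli_G.
- by move=> y; apply: integral_ge0.
Qed.

End independent_normals.

Section measurable_big.
Context {R : realType} {d : measure_display} {T : measurableType d}.

Lemma measurable_sum_cond (I : Type) (r : seq I) (Q : pred I) (h : I -> T -> R) :
  (forall i, Q i -> measurable_fun setT (h i)) ->
  measurable_fun setT (fun t => \sum_(i <- r | Q i) h i t).
Proof.
move=> mh; under eq_fun do rewrite big_mkcond; apply: measurable_sum => i.
by case: (boolP (Q i)) => [/mh|].
Qed.

Lemma measurable_prod_cond (I : eqType) (r : seq I) (Q : pred I)
    (h : I -> T -> R) : (forall i, Q i -> measurable_fun setT (h i)) ->
  measurable_fun setT (fun t => \prod_(i <- r | Q i) h i t).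
Proof.
move=> mh; under eq_fun do rewrite big_mkcond; apply: measurable_prod => i _.
by case: (boolP (Q i)) => [/mh|].
Qed.

End measurable_big.

(** * Joint moment generating function of squares of independent linear forms *)

Section linear_combinations.
Context {R : realType} {d : measure_display} {T : measurableType d}.
Context (P : probability T R) {K I : finType} (sg : K -> R) (g : K -> T -> R).
Context (grp : K -> I) (a : K -> R).
Implicit Types (th : R) (J : {set K}) (i : I).

Definition group_sum i t : R := \sum_(k | grp k == i) a k * g k t.

Definition group_variance i : R :=
  \sum_(k | grp k == i) a k ^+ 2 * sg k ^+ 2.

(** Here [J] collects the variables already integrated out: [v J i] is their share of the variance
    of group [i], and [Y J i] is what remains of the linear form. *)
Let v J i : R := \sum_(k in J | grp k == i) a k ^+ 2 * sg k ^+ 2.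

Let Y J i t : R := \sum_(k | (k \notin J) && (grp k == i)) a k * g k t.

Let vS J th i : 2 * th * group_variance i < 1 -> 2 * th * v J i < 1.
Proof.
have v0 (A : pred K) : 0 <= \sum_(k | A k) a k ^+ 2 * sg k ^+ 2.
  by apply: sumr_ge0 => k _; rewrite mulr_ge0 ?sqr_ge0.
have [th0|th0] := leP 0 th; last first.
  by move=> _; rewrite (le_lt_trans _ ltr01)// nmulr_rle0 ?v0// nmulr_llt0.
apply: le_lt_trans; rewrite ler_wpM2l ?mulr_ge0//.
rewrite /group_variance (bigID (mem J))/= /v.
under eq_bigl do rewrite andbC.
by rewrite lerDl.
Qed.

(** Variances of independent normal variables add up. Once the prefactor is pulled out, this is the
    one-variable formula with [th / D] for [th]. *)
Let integral_sqr_mgf s c y w th : 2 * th * (w + c ^+ 2 * s ^+ 2) < 1 ->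
  2 * th * w < 1 ->
  (\int[cnormal s]_x (sqr_mgf w th (c * x + y))%:E =
   (sqr_mgf (w + c ^+ 2 * s ^+ 2) th y)%:E)%E.
Proof.
move=> lt1 lt1w; set D := 1 - 2 * th * w.
have D0 : 0 < D by rewrite subr_gt0.
have E0 : 0 < 1 - 2 * th * (w + c ^+ 2 * s ^+ 2) by rewrite subr_gt0.
have DE : D * (1 - 2 * (th / D) * (c ^+ 2 * s ^+ 2)) =
    1 - 2 * th * (w + c ^+ 2 * s ^+ 2).
  by rewrite /D; field; rewrite -/D gt_eqF.
have E1 : 0 < 1 - 2 * (th / D) * (c ^+ 2 * s ^+ 2).
  by rewrite -(pmulr_rgt0 _ D0) DE.
transitivity ((Num.sqrt D)^-1%:E *
    \int[cnormal s]_x (expR (th / D * (c * x + y) ^+ 2))%:E)%E.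
  rewrite -(@ge0_integralZl_EFin _ _ _ (cnormal s) setT) ?invr_ge0 ?sqrtr_ge0//; last first.
    by apply/measurable_EFinP; exact: measurable_expR_sqr.
  apply: eq_integral => x _; rewrite -EFinM /sqr_mgf -/D.
  by rewrite mulrAC.
rewrite (integral_normal_expR_sqr _ _ _ (th / D)); last by rewrite -subr_gt0.
rewrite -EFinM /sqr_mgf -DE.
rewrite sqrtrM ?(ltW D0)// invfM; congr EFin.
rewrite -[RHS]mulrA; congr (_ * (_ * expR _)).
field.
by rewrite gt_eqF//= (_ : _ - _ = 1 - 2 * th * (w + c ^+ 2 * s ^+ 2)) ?gt_eqF// /D; ring.
Qed.

Hypothesis ind : independent_normals P sg g.

(** Only the factor of the group of [k0] involves [g k0]; integrating it out moves one term from [Y]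
    to [v]. *)
Let integral_step J k0 th : k0 \notin J ->
  (forall i, 2 * th * group_variance i < 1) ->
  (\int[P]_t (\prod_i sqr_mgf (v J i) th (Y J i t))%:E =
   \int[P]_t (\prod_i sqr_mgf (v (k0 |: J) i) th (Y (k0 |: J) i t))%:E)%E.
Proof.
move=> k0J lt1; set J' := k0 |: J; set i0 := grp k0.
(* The first coordinate carries [g k0]; the second enters only through the other variables, so [F]
   is measurable for the coarser sigma-algebra. *)
pose F (z : measurableTypeR R * others_type g k0) : \bar R :=
  (sqr_mgf (v J i0) th (a k0 * z.1 + Y J' i0 z.2) *
   \prod_(i | i != i0) sqr_mgf (v J i) th (Y J i z.2))%:E.
have F0 z : (0 <= F z)%E.
  by rewrite lee_fin mulr_ge0 ?sqr_mgf_ge0// prodr_ge0// => i _; exact: sqr_mgf_ge0.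
have msqr d' (T' : measurableType d') w (f : T' -> R) :
    measurable_fun setT f -> measurable_fun setT (fun t => sqr_mgf w th (f t)).
  move=> mf; apply: measurable_funM => //; apply: measurableT_comp => //.
  apply: measurable_funM => //; apply: measurable_funM => //.
  exact: measurable_funX.
have mY J1 i : (k0 \in J1) || (i != i0) ->
    measurable_fun [set: others_type g k0] (Y J1 i).
  move=> h; apply: measurable_sum_cond => k /andP[kJ1 /eqP gk].
  apply: measurable_funM => //; apply: measurable_others.
  apply: contraTneq h => k0E; rewrite negb_or negbK -{1}k0E kJ1 -gk k0E.
  exact/eqP.
have mF : measurable_fun setT F.
  apply/measurable_EFinP; apply: measurable_funM.
    apply: msqr; apply: measurable_funD.
      by apply: measurable_funM => //; exact: measurable_fst.
    apply: (measurableT_comp (mY _ _ _) measurable_snd).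
    by rewrite /J' setU11.
  apply: measurable_prod_cond => i ii0; apply: msqr.
  by apply: (measurableT_comp (mY _ _ _) measurable_snd); rewrite ii0 orbT.
transitivity (\int[P]_t F (g k0 t, t))%E.
  apply: eq_integral => t _; congr EFin; rewrite (bigD1 i0)//=.
  congr (sqr_mgf _ _ _ * _); rewrite /Y (bigD1 k0)/= ?k0J ?eqxx//.
  congr (_ + _); apply: eq_bigl => k.
  by rewrite in_setU1 negb_or andbC andbA.
rewrite (integral_independent _ _ _ ind _ _ mF F0); apply: eq_integral => t _.
have vJ' i : v J' i = v J i + (if i == i0 then a k0 ^+ 2 * sg k0 ^+ 2 else 0).
  have [->|ii0] := eqVneq i i0.
    rewrite /v (bigD1 k0)/= ?setU11 ?eqxx// addrC; congr (_ + _).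
    apply: eq_bigl => k; rewrite in_setU1.
    by have [->|] := eqVneq k k0; rewrite ?(negbTE k0J)//= ?andbF ?andbT.
  rewrite addr0 /v; apply: eq_bigl => k; rewrite in_setU1.
  have [->|//] := eqVneq k k0; rewrite (negbTE k0J)/=.
  by apply/negbTE; rewrite eq_sym.
rewrite (bigD1 i0)//= vJ' eqxx [in RHS]EFinM.
rewrite -integral_sqr_mgf; last 2 first.
- by have := vS J' _ _ (lt1 i0); rewrite vJ' eqxx.
- exact: (vS _ _ _ (lt1 i0)).
rewrite [X in (_ * X)%E](_ : _ =
    (\prod_(i | i != i0) sqr_mgf (v J i) th (Y J i t))%:E); last first.
  congr EFin; apply: eq_bigr => i ii0; rewrite vJ' (negbTE ii0) addr0.
  congr (sqr_mgf _ _ _); apply: eq_bigl => k; rewrite in_setU1.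
  have [->|//] := eqVneq k k0.
  by rewrite (_ : grp k0 == i = false) ?andbF//; apply/negbTE; rewrite eq_sym.
rewrite -ge0_integralZr//.
- by apply/measurable_EFinP; apply: msqr; apply: measurable_funD => //; exact: measurable_funM.
- by move=> x _; rewrite lee_fin sqr_mgf_ge0.
- by rewrite lee_fin prodr_ge0// => i _; exact: sqr_mgf_ge0.
Qed.

(** The variables are integrated out one at a time. For empty [J] the product is the exponential
    itself; for full [J] every [Y] vanishes and the integrand is constant. *)
Theorem expectation_expR_sum_sqr th :
  (forall i, 2 * th * group_variance i < 1) ->
  (\int[P]_t (expR (th * \sum_i group_sum i t ^+ 2))%:E =
   (\prod_i (Num.sqrt (1 - 2 * th * group_variance i))^-1)%:E)%E.
Proof.
move=> lt1.
have stepJ (s : seq K) : uniq s ->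
  (\int[P]_t (\prod_i sqr_mgf (v finset.set0 i) th (Y finset.set0 i t))%:E =
   \int[P]_t (\prod_i sqr_mgf (v [set x in s]%SET i) th (Y [set x in s]%SET i t))%:E)%E.
  elim: s => [_|k s ih /= /andP[ks us]]; first by rewrite (_ : [set x in [::]]%SET = finset.set0)//; apply/setP => k; rewrite !inE.
  rewrite (ih us) (_ : [set x in k :: s]%SET = k |: [set x in s]%SET)%SET; last first.
    by apply/setP => l; rewrite !inE.
  by apply: integral_step => //; rewrite inE.
transitivity (\int[P]_t (\prod_i sqr_mgf (v finset.set0 i) th (Y finset.set0 i t))%:E)%E.
  apply: eq_integral => t _; rewrite mulr_sumr expR_sum; congr EFin.
  apply: eq_bigr => i _; rewrite [v finset.set0 i]big1 => [|k]; last by rewrite inE.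
  rewrite sqr_mgf0; congr (expR (_ * _ ^+ 2)).
  by apply: eq_bigl => k; rewrite inE.
rewrite (stepJ (enum K)) ?enum_uniq//.
rewrite (_ : [set x in enum K]%SET = finset.setT); last first.
  by apply/setP => k; rewrite !inE mem_enum.
under eq_integral => t _.
  rewrite (_ : \prod_i _ = \prod_i (Num.sqrt (1 - 2 * th * group_variance i))^-1).
    over.
  apply: eq_bigr => i _; rewrite [Y _ _ _]big1 => [|k]; last by rewrite inE.
  rewrite /sqr_mgf expr0n mulr0 mul0r expR0 mulr1.
  by congr (Num.sqrt (1 - _ * _))^-1; apply: eq_bigl => k; rewrite inE.
rewrite integral_cst// [X in (_ * X)%E](_ : _ = 1%E) ?mule1//.
exact: probability_setT.
Qed.

End linear_combinations.

(** * Tails of sums of squares *)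

Section chi_square_tail.
Context {R : realType} {d : measure_display} {T : measurableType d}.
Context (P : probability T R) {K I : finType} (sg : K -> R) (g : K -> T -> R).
Context (grp : K -> I) (a : K -> R).
Hypothesis ind : independent_normals P sg g.
Local Notation U := (group_sum g grp a).

Lemma measurable_group_sum i : measurable_fun setT (U i).
Proof.
by apply: measurable_sum_cond => k _; apply: measurable_funM => //; exact: ind.1.
Qed.

(** After squaring, use [1 + u <= expR u] and [(1 - x) * (1 + x + 2 * x ^+ 2) = 1 + x ^+ 2 * (1 - 2
    * x)]. *)
Lemma invr_sqrt_le_expR (x : R) : x <= 1 / 2 ->
  (Num.sqrt (1 - x))^-1 <= expR (x / 2 + x ^+ 2).
Proof.
move=> x2; have x1 : 0 < 1 - x by lra.
rewrite -[leLHS]mul1r ler_pdivrMr ?sqrtr_gt0//.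
rewrite -(@ler_pXn2r _ 2)// ?nnegrE ?mulr_ge0 ?expR_ge0 ?sqrtr_ge0//.
rewrite expr1n exprMn sqr_sqrtr ?(ltW x1)// [expR _ ^+ 2]expr2 -expRD.
have h : 1 + (x / 2 + x ^+ 2 + (x / 2 + x ^+ 2)) <=
    expR (x / 2 + x ^+ 2 + (x / 2 + x ^+ 2)) by exact: expR_ge1Dx.
rewrite (le_trans _ (ler_wpM2r (ltW x1) h))// -subr_ge0.
rewrite [leRHS](_ : _ = x ^+ 2 * (1 - 2 * x)); last by field.
by rewrite mulr_ge0 ?sqr_ge0//; lra.
Qed.

(** Chernoff's bound with parameter [V^-1]. Positive [th] yields the upper tail and negative [th]
    the lower one; a positive bound [V] in place of [v] covers degenerate laws. *)
Lemma sum_sqr_tail (v V th r : R) :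
  (forall i, group_variance sg grp a i = v) -> 0 <= v <= V -> 0 < V ->
  `|th| <= 1 / 4 ->
  (P [set t | #|I|%:R * th * v + V * (4 * #|I|%:R * th ^+ 2 + r) <
      th * \sum_i U i t ^+ 2]%R <= (expR (- r))%:E)%E.
Proof.
move=> vE /andP[v0 vV] V0 th4; set N := #|I|.
set b := (X in [set t | X < _]).
pose X t := th * \sum_i U i t ^+ 2.
have mX : measurable_fun setT X.
  apply: measurable_funM => //; apply: measurable_sum => i.
  by apply: measurable_funX; exact: measurable_group_sum.
(* With this [x], [N * x / 2] is the mean term divided by [V], and [N * x ^+ 2] is at most
   [4 * N * th ^+ 2]. *)
pose x := 2 * (th / V) * v.
have uV0 : 0 <= v / V by rewrite divr_ge0 ?(ltW V0).
have uV1 : v / V <= 1 by rewrite ler_pdivrMr// mul1r.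
have xE : x = 2 * (th * (v / V)) by rewrite /x; ring.
have x2 : x <= 1 / 2.
  by move: th4; rewrite ler_norml xE => /andP[? ?]; nra.
have Mle : ('M_P (mfun_Sub (mem_set mX)) V^-1 <=
    (expR (N%:R * (x / 2 + x ^+ 2)))%:E)%E.
  rewrite /mmt_gen_fun unlock.
  rewrite [leLHS](_ : _ = \int[P]_t (expR (th / V * \sum_i U i t ^+ 2))%:E)%E; last first.
    apply: eq_integral => t _ /=; congr (expR _)%:E.
    by rewrite /X; ring.
  rewrite (expectation_expR_sum_sqr _ _ _ _ _ ind) => [|i]; last by rewrite vE -/x; lra.
  rewrite lee_fin [leLHS](_ : _ = (Num.sqrt (1 - x))^-1 ^+ N); last first.
    by under eq_bigr do rewrite vE; rewrite prodr_const.
  by rewrite expRM_natl lerXn2r ?nnegrE ?invr_ge0 ?sqrtr_ge0 ?expR_ge0 ?invr_sqrt_le_expR.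
rewrite (@le_trans _ _ (P [set t | b <= X t]%R))//.
  apply: le_measure; rewrite ?inE.
  - by rewrite -[X in measurable X]setTI; exact: (measurable_fun_ltr _ _).
  - by rewrite -[X in measurable X]setTI; exact: (measurable_fun_ler _ _).
  - by move=> t /= /ltW.
have iV0 : 0 < V^-1 by rewrite invr_gt0.
have ch : (P [set t | b <= X t]%R <=
    'M_P (mfun_Sub (mem_set mX)) V^-1 * (expR (- (V^-1 * b)))%:E)%E.
  exact: chernoff.
apply: (le_trans ch).
rewrite (le_trans (lee_wpmul2r _ Mle)) ?lee_fin ?expR_ge0// -expRD ler_expR.
have -> : V^-1 * b = N%:R * (th * (v / V)) + 4 * N%:R * th ^+ 2 + r.
  by rewrite /b; field; rewrite gt_eqF.
have : (v / V) ^+ 2 * th ^+ 2 <= th ^+ 2.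
  by rewrite ler_piMl ?sqr_ge0// expr_le1.
have N0 : 0 <= N%:R :> R by [].
rewrite xE => /(ler_wpM2l N0) h.
rewrite -subr_ge0 [leRHS](_ : _ =
  4 * (N%:R * th ^+ 2 - N%:R * ((v / V) ^+ 2 * th ^+ 2))); last by field; rewrite gt_eqF.
by rewrite mulr_ge0// subr_ge0.
Qed.

End chi_square_tail.

(** * The scalar variables of the additive error model *)

Section measurable_entries.
Context {R : realType}.

Lemma measurable_entry {m n} (i : 'I_m) (j : 'I_n) :
  measurable_fun setT (fun M : 'M[R]_(m, n) => M i j).
Proof.
move=> _ A mA; apply: sub_sigma_algebra; exists i, j; by exists A.
Qed.

Lemma measurable_to_matrix {d} {T : measurableType d} {m n} (f : T -> 'M[R]_(m, n)) :
  (forall i j, measurable_fun setT (fun t => f t i j)) -> measurable_fun setT f.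
Proof.
move=> mf; apply: (measurability (@mx_cylinder _ R m n)) => // _ [_ [i [j [B mB <-]]] <-].
by have := mf i j measurableT B mB; rewrite !setTI.
Qed.

Lemma measurable_row_box {n} (A : 'I_n -> set R) : (forall j, measurable (A j)) ->
  measurable [set x : 'rV[R]_n | forall j, A j (x 0 j)].
Proof.
move=> mA; rewrite [X in measurable X](_ : _ = \bigcap_(j in [set` enum 'I_n])
    ((fun x : 'rV[R]_n => x 0 j) @^-1` A j)); last first.
  by apply/seteqP; split=> [t h k _|t h k]; [exact: h|apply: h; rewrite /= mem_enum].
rewrite bigcap_seq; apply: bigsetI_measurable => k _.
by rewrite -[X in measurable X]setTI; exact: measurable_entry.
Qed.

End measurable_entries.

Section scalar_variables.
Context {R : realType} {d : measure_display} {T : measurableType d}.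
Context (P : probability T R) {m n : nat} (sx sw se : R).
Context (X W : 'I_m -> {RV P >-> 'rV[R]_n}) (e : 'I_m -> {RV P >-> R}).

Definition scalar_index : finType := ('I_m * 'I_n + 'I_m * 'I_n + 'I_m)%type.

Definition scalar_variable (k : scalar_index) (t : T) : R :=
  match k with
  | inl (inl ij) => X ij.1 t 0 ij.2
  | inl (inr ij) => W ij.1 t 0 ij.2
  | inr i => e i t
  end.

Definition scalar_deviation (k : scalar_index) : R :=
  match k with inl (inl _) => sx | inl (inr _) => sw | inr _ => se end.

Hypothesis setting : additive_error_setting sx sw se X W e.

(** A box splits into one event per vector, to which mutual independence applies; within each vector
    the law on boxes is already a product. *)
Lemma independent_scalars :
  independent_normals P scalar_deviation scalar_variable.
Proof.
have [lawX lawW lawe ind] := setting; split.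
  move=> [[[i j]|[i j]]|i] /=.
  - exact: (measurableT_comp (measurable_entry 0 j) (measurable_funPT (X i))).
  - exact: (measurableT_comp (measurable_entry 0 j) (measurable_funPT (W i))).
  - exact: measurable_funPT.
move=> A mA.
pose E (k : 'I_m + 'I_m + 'I_m) : set T := match k with
  | inl (inl i) => X i @^-1` [set x | forall j, A (inl (inl (i, j))) (x 0 j)]
  | inl (inr i) => W i @^-1` [set x | forall j, A (inl (inr (i, j))) (x 0 j)]
  | inr i => e i @^-1` A (inr i)
  end.
rewrite (_ : [set t | _] =
    \bigcap_(k in [set` (finset.setT : {set 'I_m + 'I_m + 'I_m})]) E k); last first.
  apply/seteqP; split=> [t h [[i|i]|i] _ /= |t h [[[i j]|[i j]]|i]].
  - by move=> j; exact: (h (inl (inl (i, j)))).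
  - by move=> j; exact: (h (inl (inr (i, j)))).
  - exact: (h (inr i)).
  - by have := h (inl (inl i)); rewrite /= inE => /(_ isT); exact.
  - by have := h (inl (inr i)); rewrite /= inE => /(_ isT); exact.
  - by have := h (inr i); rewrite /= inE => /(_ isT).
rewrite ind; last first.
  move=> [[i|i]|i] _ /=.
  - exists [set x : 'rV[R]_n | forall j, A (inl (inl (i, j))) (x 0 j)]; last by rewrite setTI.
    exact: (measurable_row_box (fun j => A (inl (inl (i, j)))) (fun j => mA _)).
  - exists [set x : 'rV[R]_n | forall j, A (inl (inr (i, j))) (x 0 j)]; last by rewrite setTI.
    exact: (measurable_row_box (fun j => A (inl (inr (i, j)))) (fun j => mA _)).
  - by exists (A (inr i)); rewrite ?setTI.
under eq_bigl do rewrite inE.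
rewrite !big_sumType/=; congr (_ * _ * _)%E.
- transitivity (\prod_i \prod_j cnormal sx (A (inl (inl (i, j)))))%E; last first.
    by rewrite pair_bigA; apply: eq_bigr => -[i j] _.
  apply: eq_bigr => i _; under [RHS]eq_bigr do rewrite cnormalE.
  by rewrite -(lawX i (fun j => A (inl (inl (i, j)))) (fun j => mA _)).
- transitivity (\prod_i \prod_j cnormal sw (A (inl (inr (i, j)))))%E; last first.
    by rewrite pair_bigA; apply: eq_bigr => -[i j] _.
  apply: eq_bigr => i _; under [RHS]eq_bigr do rewrite cnormalE.
  by rewrite -(lawW i (fun j => A (inl (inr (i, j)))) (fun j => mA _)).
- by apply: eq_bigr => i _; rewrite cnormalE -(lawe i _ (mA (inr i))).
Qed.

End scalar_variables.

Lemma sum_fst_fiber {R : realType} {I J : finType} (i : I) (F : I * J -> R) :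
  \sum_(p | p.1 == i) F p = \sum_j F (i, j).
Proof.
transitivity (\sum_(i' | i' == i) \sum_j F (i', j)); last by rewrite big_pred1_eq.
rewrite pair_big /=; apply: eq_big => [p|[? ?] //]; by rewrite andbT.
Qed.

Section tails.
Context {R : realType} {d : measure_display} {T : measurableType d}.
Context {P : probability T R} {m n : nat} {sx sw se : R}.
Context {X W : 'I_m -> {RV P >-> 'rV[R]_n}} {e : 'I_m -> {RV P >-> R}}.
Hypothesis setting : additive_error_setting sx sw se X W e.
Implicit Types (V th r : R).

Lemma row_form_tail (aX aW : 'I_n -> R) (ae v V th r : R) :
  v = \sum_j aX j ^+ 2 * sx ^+ 2 + \sum_j aW j ^+ 2 * sw ^+ 2 +
      ae ^+ 2 * se ^+ 2 ->
  v <= V -> 0 < V -> `|th| <= 1 / 4 ->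
  (P [set t | m%:R * th * v + V * (4 * m%:R * th ^+ 2 + r) <
      th * \sum_i (\sum_j aX j * X i t 0 j + \sum_j aW j * W i t 0 j +
                   ae * e i t) ^+ 2]%R <= (expR (- r))%:E)%E.
Proof.
move=> vE vV V0 th4.
pose grp (k : @scalar_index m n) : 'I_m :=
  match k with inl (inl p) => p.1 | inl (inr p) => p.1 | inr i => i end.
pose a (k : @scalar_index m n) : R :=
  match k with inl (inl p) => aX p.2 | inl (inr p) => aW p.2 | inr i => ae end.
have v0 : 0 <= v <= V.
  rewrite vV andbT vE -exprMn !addr_ge0 ?sqr_ge0 ?sumr_ge0// => j _;
    by rewrite -exprMn sqr_ge0.
have gv i : group_variance (scalar_deviation sx sw se) grp a i = v.
  rewrite /group_variance !big_sumType/= !sum_fst_fiber/= vE.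
  by rewrite (big_pred1 i).
have := sum_sqr_tail _ _ _ _ _ (independent_scalars _ _ _ _ _ _ _ setting)
  _ _ _ r gv v0 V0 th4.
rewrite card_ord; congr (P _ <= _)%E; apply/funext => t.
congr (is_true (_ < _ * _)); apply: eq_bigr => i _; congr (_ ^+ 2).
by rewrite /group_sum !big_sumType/= !sum_fst_fiber/= (big_pred1 i).
Qed.

Lemma all_entries_tail V th r : (0 < n)%N -> sx ^+ 2 + sw ^+ 2 <= V -> 0 < V ->
  `|th| <= 1 / 4 ->
  (P [set t | (m * n)%:R * th * (sx ^+ 2 + sw ^+ 2) +
                V * (4 * (m * n)%:R * th ^+ 2 + r) <
      th * \sum_i \sum_j (X i t 0 j + W i t 0 j) ^+ 2]%R <=
      (expR (- r))%:E)%E.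
Proof.
move=> n0 vV V0 th4.
(* Each entry is a group of its own. The variables [e i] must lie in some group: they go to column
   0, with coefficient 0. *)
pose grp (k : @scalar_index m n) : 'I_m * 'I_n :=
  match k with inl (inl p) => p | inl (inr p) => p | inr i => (i, Ordinal n0) end.
pose a (k : @scalar_index m n) : R := if k is inl _ then 1 else 0.
have v0 : 0 <= sx ^+ 2 + sw ^+ 2 <= V by rewrite vV addr_ge0 ?sqr_ge0.
have gv p : group_variance (scalar_deviation sx sw se) grp a p = sx ^+ 2 + sw ^+ 2.
  rewrite /group_variance !big_sumType/= !(big_pred1 p)//= big1 => [|i _].
    by rewrite expr1n !mul1r addr0.
  by rewrite expr0n mul0r.
have := sum_sqr_tail _ _ _ _ _ (independent_scalars _ _ _ _ _ _ _ setting)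
  _ _ _ r gv v0 V0 th4.
rewrite card_prod !card_ord; congr (P _ <= _)%E; apply/funext => t.
congr (is_true (_ < _ * _)); rewrite pair_bigA; apply: eq_bigr => p _.
congr (_ ^+ 2); rewrite /group_sum !big_sumType/= !(big_pred1 p)//=.
rewrite big1 => [|i _]; last by rewrite mul0r.
by rewrite !mul1r addr0.
Qed.

End tails.

(** * Deterministic bounds *)

Section restricted_eigenvalue_consequences.
Context {R : realType} {m n : nat}.
Implicit Types (b : 'cV[R]_n) (Z : 'M[R]_(m, n)) (q r x y : R).

Lemma sqr_l2norm b : l2norm b ^+ 2 = \sum_j b j 0 ^+ 2.
Proof. by rewrite sqr_sqrtr// sumr_ge0// => j _; exact: sqr_ge0. Qed.

Lemma Gamma_hat_form s Z b : (b^T *m Gamma_hat s Z *m b) 0 0 =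
  m%:R^-1 * \sum_i (Z *m b) i 0 ^+ 2 - s ^+ 2 * l2norm b ^+ 2.
Proof.
have dot k (u : 'cV[R]_k) : (u^T *m u) 0 0 = \sum_j u j 0 ^+ 2.
  by rewrite mxE; apply: eq_bigr => j _; rewrite mxE expr2.
rewrite /Gamma_hat mulmxBr mulmxBl mxE [X in _ + X]mxE; congr (_ - _).
  rewrite -scalemxAr -scalemxAl mxE; congr (_ * _).
  by rewrite mulmxA -trmx_mul -mulmxA dot.
by rewrite mul_mx_scalar -scalemxAl mxE dot sqr_l2norm.
Qed.

Definition lq_term q x : R := if x == 0 then 0 else `|x| `^ q.

Lemma lq_term_ge0 q x : 0 <= lq_term q x.
Proof. by rewrite /lq_term; case: ifP => // _; exact: powR_ge0. Qed.

Lemma lq_termN q x : lq_term q (- x) = lq_term q x.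
Proof. by rewrite /lq_term oppr_eq0 normrN. Qed.

(** For positive [a], write [a ^ q] as [a] times [a ^ (q - 1)], whose second factor is nonincreasing
    in [a]. *)
Lemma lq_termD q x y : 0 <= q <= 1 ->
  lq_term q (x + y) <= lq_term q x + lq_term q y.
Proof.
move=> /andP[q0 q1]; rewrite {2}/lq_term; case: eqVneq => [->|x0].
  by rewrite !add0r.
rewrite {2}/lq_term; case: eqVneq => [->|y0].
  by rewrite !addr0 /lq_term (negbTE x0).
rewrite /lq_term; case: ifPn => [_|xy0]; first by rewrite addr_ge0 ?powR_ge0.
have nx : 0 < `|x| by rewrite normr_gt0.
have ny : 0 < `|y| by rewrite normr_gt0.
apply: (@le_trans _ _ ((`|x| + `|y|) `^ q)).
  by rewrite ge0_ler_powR ?nnegrE ?addr_ge0// ler_normD.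
have split a : 0 < a -> a `^ q = a * a `^ (q - 1).
  by move=> a0; rewrite -{2}(powRr1 (ltW a0)) -powRD ?(gt_eqF a0) ?implybT// subrKC.
rewrite !split ?addr_gt0// mulrDl.
have anti a c : 0 < a -> a <= c -> c `^ (q - 1) <= a `^ (q - 1).
  move=> a0 ac; have c0 := lt_le_trans a0 ac.
  rewrite -(opprB 1 q) !powRN lef_pV2 ?posrE ?powR_gt0//.
  by rewrite ge0_ler_powR ?nnegrE ?subr_ge0 ?(ltW a0) ?(ltW c0).
by rewrite lerD// ler_wpM2l ?(ltW nx) ?(ltW ny)//; apply: anti => //;
  rewrite ?lerDl ?lerDr ltW.
Qed.

(** This places the estimation error in the ball on which the restricted eigenvalue condition is
    assumed. *)
Lemma lq_ballB q r b1 b2 : 0 <= q <= 1 -> lq_ball n q r b1 -> lq_ball n q r b2 ->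
  lq_ball n q (2 * r) (b1 - b2).
Proof.
move=> q01 h1 h2; rewrite /lq_ball/=.
rewrite mulr_natl mulr2n (le_trans _ (lerD h1 h2))// -big_split/=.
apply: ler_sum => j _; rewrite !mxE -[leLHS]/(lq_term q (_ - _)).
by rewrite (le_trans (lq_termD _ _ _ q01))// lq_termN.
Qed.

(** Entries of a unit vector are at most 1 in absolute value, so each square is at most the
    corresponding q-th power. *)
Lemma lq_sphere_radius_ge1 q r b : 0 <= q <= 1 -> lq_ball n q r b ->
  l2sphere n b -> 1 <= r.
Proof.
move=> /andP[q0 q1] hb s1; apply: le_trans hb.
have sq1 : \sum_j b j 0 ^+ 2 = 1 by rewrite -sqr_l2norm s1 expr1n.
rewrite -{1}sq1; apply: ler_sum => j _.
case: eqVneq => [->|bj0]; first by rewrite expr0n.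
have bj1 : `|b j 0| <= 1.
  rewrite -(@ler_pXn2r _ 2)// ?nnegrE// expr1n real_normK ?num_real// -sq1.
  by rewrite (bigD1 j)//= lerDl sumr_ge0// => k _; exact: sqr_ge0.
rewrite -real_normK ?num_real// -powR_mulrn//.
by apply: ger_powR; rewrite ?normr_gt0 ?bj0// (le_trans q1)// ler1n.
Qed.

(** The condition is tested on the coordinate vectors, the bias correction is dropped, and the
    results are averaged over the columns. *)
Lemma restricted_eigenvalue_average q r kappa tau s Z : (0 < n)%N ->
  1 <= r -> restricted_eigenvalue q r kappa tau (Gamma_hat s Z) ->
  kappa - tau <= (m%:R * n%:R)^-1 * \sum_i \sum_j Z i j ^+ 2.
Proof.
move=> n0 r1 RE.
have col j : kappa - tau <= m%:R^-1 * \sum_i Z i j ^+ 2.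
  have dj k : (delta_mx j 0 : 'cV[R]_n) k 0 = (k == j)%:R by rewrite mxE eqxx andbT.
  have : lq_ball n q r (delta_mx j 0).
    rewrite /lq_ball/= (bigD1 j)//= big1 => [|k kj]; last by rewrite dj (negbTE kj) eqxx.
    by rewrite addr0 dj eqxx oner_eq0 normr1 powR1.
  move/RE; rewrite Gamma_hat_form sqr_l2norm.
  rewrite [\sum_(k < n) _](bigD1 j)//= big1 => [|k kj].
    rewrite dj eqxx expr1n addr0 !mulr1 => /le_trans; apply.
    rewrite lerBlDr (eq_bigr (fun i => Z i j ^+ 2)) ?lerDl ?sqr_ge0// => i _.
    by rewrite -colE mxE.
  by rewrite dj (negbTE kj) expr0n.
have : \sum_(j < n) (kappa - tau) <= \sum_j (m%:R^-1 * \sum_i Z i j ^+ 2).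
  exact: ler_sum.
rewrite sumr_const card_ord -mulr_sumr exchange_big/= -[X in X <= _]mulr_natl.
have n0R : 0 < n%:R :> R by rewrite ltr0n.
by rewrite -ler_pdivlMl// mulrA -invfM [n%:R * _]mulrC.
Qed.

End restricted_eigenvalue_consequences.

(** * Basic inequalities for a near-minimiser of the least squares loss *)

Section basic_inequality.
Context {R : realType} {m n : nat}.

Definition sqr_loss (y : 'cV[R]_m) (Z : 'M[R]_(m, n)) (b : 'cV[R]_n) : R :=
  m%:R^-1 * \sum_i (y i 0 - (Z *m b) i 0) ^+ 2.

Context {y : 'cV[R]_m} {Z : 'M[R]_(m, n)} {xi : 'I_m -> R} {bs bh : 'cV[R]_n}.
Context {eps : R}.
Hypothesis yE : forall i, y i 0 = (Z *m bs) i 0 + xi i.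
Hypothesis loss_le : sqr_loss y Z bh <= sqr_loss y Z bs + eps.
Hypotheses (bs1 : l2sphere n bs) (bh1 : l2sphere n bh).
Local Notation D := (bh - bs).

Let sq1 (b : 'cV[R]_n) : l2sphere n b -> \sum_j b j 0 ^+ 2 = 1.
Proof. by move=> s1; rewrite -sqr_l2norm s1 expr1n. Qed.

Let loss_bs : sqr_loss y Z bs = m%:R^-1 * \sum_i xi i ^+ 2.
Proof. by congr (_ * _); apply: eq_bigr => i _; rewrite yE addrAC subrr add0r. Qed.

Let loss_bh : sqr_loss y Z bh = m%:R^-1 * \sum_i (xi i - (Z *m D) i 0) ^+ 2.
Proof.
congr (_ * _); apply: eq_bigr => i _; congr (_ ^+ 2).
have -> : (Z *m D) i 0 = (Z *m bh) i 0 - (Z *m bs) i 0 by rewrite mulmxBr !mxE.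
by rewrite yE; ring.
Qed.

Lemma sqr_l2norm_sphereB_le : l2norm D ^+ 2 <= 4.
Proof.
rewrite sqr_l2norm (@le_trans _ _ (\sum_j (2 * bh j 0 ^+ 2 + 2 * bs j 0 ^+ 2)))//.
  apply: ler_sum => j _; rewrite !mxE -subr_ge0.
  by rewrite [leRHS](_ : _ = (bh j 0 + bs j 0) ^+ 2) ?sqr_ge0//; ring.
by rewrite big_split/= -!mulr_sumr !sq1//; lra.
Qed.

(* On the unit sphere the quadratic correction [s ^+ 2 * l2norm b ^+ 2] of the
   corrected loss is constant, and [l2norm D ^+ 2 = - 2 * <bs, D>]. *)
Lemma Gamma_hat_deviation s : (D^T *m Gamma_hat s Z *m D) 0 0 <=
  2 * (\sum_j (m%:R^-1 * (\sum_i Z i j * xi i) + s ^+ 2 * bs j 0) * D j 0) + eps.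
Proof.
have DE : l2norm D ^+ 2 = - 2 * \sum_j bs j 0 * D j 0.
  have : \sum_j bh j 0 ^+ 2 = \sum_j bs j 0 ^+ 2 + 2 * (\sum_j bs j 0 * D j 0) +
      l2norm D ^+ 2.
    rewrite sqr_l2norm mulr_sumr -!big_split/=; apply: eq_bigr => j _.
    by rewrite !mxE; ring.
  by rewrite !sq1//; lra.
rewrite Gamma_hat_form DE; move: loss_le; rewrite loss_bs loss_bh.
have -> : \sum_j (m%:R^-1 * (\sum_i Z i j * xi i) + s ^+ 2 * bs j 0) * D j 0 =
    m%:R^-1 * (\sum_i xi i * (Z *m D) i 0) + s ^+ 2 * \sum_j bs j 0 * D j 0.
  rewrite !mulr_sumr; under eq_bigr do rewrite mulrDl -mulrA.
  rewrite big_split/=; congr (_ + _); last by apply: eq_bigr => j _; rewrite mulrA.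
  rewrite -!mulr_sumr; congr (_ * _).
  under eq_bigr do rewrite mulr_suml.
  rewrite exchange_big/=; apply: eq_bigr => i _; rewrite mxE mulr_sumr.
  by apply: eq_bigr => j _; ring.
have -> : \sum_i (xi i - (Z *m D) i 0) ^+ 2 = \sum_i xi i ^+ 2 -
    2 * (\sum_i xi i * (Z *m D) i 0) + \sum_i (Z *m D) i 0 ^+ 2.
  rewrite mulr_sumr -sumrB -big_split/=; apply: eq_bigr => i _; ring.
by nra.
Qed.

(** From [|Z D|^2 <= 2 |xi|^2 + 2 |xi - Z D|^2], whose last term is the loss at [bh]. No cross
    moment enters, so this serves when [L] is large or the noise vanishes. *)
Lemma Gamma_hat_noise s : (D^T *m Gamma_hat s Z *m D) 0 0 <=
  4 * (m%:R^-1 * \sum_i xi i ^+ 2) + 2 * eps.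
Proof.
rewrite Gamma_hat_form (@le_trans _ _ (m%:R^-1 * \sum_i (Z *m D) i 0 ^+ 2))//.
  by rewrite gerBl -exprMn sqr_ge0.
apply: (@le_trans _ _ (2 * sqr_loss y Z bs + 2 * sqr_loss y Z bh)).
  rewrite loss_bs loss_bh 2!(mulrCA 2) -mulrDr ler_wpM2l ?invr_ge0//.
  rewrite !mulr_sumr -big_split/=; apply: ler_sum => i _; rewrite -subr_ge0.
  by rewrite [leRHS](_ : _ = (2 * xi i - (Z *m D) i 0) ^+ 2) ?sqr_ge0//; ring.
by move: loss_le; rewrite loss_bs; lra.
Qed.

End basic_inequality.

(** * From quadratic inequalities to the rate *)

Section rate.
Context {R : realType}.
Implicit Types (q k u s x D : R).

(** Separates the stochastic part of the rate from the part [k^-1] that pays for [tau] and for the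
    tolerance of the minimisation. *)
Lemma rate_split q k a b : 0 < k -> 0 <= a -> 0 <= b ->
  (a `^ (2 - q) * b `^ (2 - q) + k `^ (1 - q)) / k `^ (2 - q) =
  (a * b / k) `^ (2 - q) + k^-1.
Proof.
move=> k0 a0 b0; have kn := gt_eqF k0.
rewrite mulrDl -powRM// [in RHS]powRM ?mulr_ge0 ?invr_ge0 ?(ltW k0)//; congr (_ * _ + _).
  by rewrite -!(powR_inv1 (ltW k0)) -powRrM -powR_inv1 ?powR_ge0// -powRrM mulrC.
by rewrite -powRB ?kn ?implybT// -powR_inv1 ?(ltW k0)//; congr (_ `^ _); ring.
Qed.

Lemma powR_pge1 x (t : R) : 1 <= x -> 0 <= t -> 1 <= x `^ t.
Proof. by move=> x1 t0; rewrite -(powRr0 x) ler_powR. Qed.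

(* Either [x >= 1] and the trivial bound [4] does, or [x <= x `^ t]. *)
Lemma le_capped_powR D b x (t : R) : 0 <= b -> 0 <= x -> 0 <= t <= 1 ->
  D <= 4 -> D <= b + x -> D <= b + 4 * x `^ t.
Proof.
move=> b0 x0 /andP[t0 t1] D4 Dx; have [x1|x1] := leP 1 x.
  by have := powR_pge1 _ _ x1 t0; lra.
have [xe0|xn0] := eqVneq x 0; first by have := powR_ge0 x t; move: Dx; lra.
have : x <= x `^ t by rewrite ger1_powR// lt_neqAle eq_sym xn0 x0 ltW.
by have := powR_ge0 x t; lra.
Qed.

Lemma noise_rate q k D (c E sz sxi L Rq : R) : 0 <= q <= 1 -> 0 < k -> 0 <= c ->
  0 <= L -> 1 <= Rq -> 0 <= sz -> 0 <= sxi ->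
  E = Rq * L `^ (1 - q / 2) -> k <= 12 * sz ^+ 2 -> D <= 4 ->
  k * D <= (c + 3) * E + 24 * (sxi ^+ 2 * L) ->
  D <= (c + 3) * k^-1 * E + 1152 * (sz * sxi / k) `^ (2 - q) * E.
Proof.
move=> /andP[q0 q1] k0 c0 L0 Rq1 sz0 sxi0 EE ksz D4 kD.
have E0 : 0 <= E by rewrite EE mulr_ge0 ?powR_ge0//; lra.
set u := sz * sxi / k; have u0 : 0 <= u by rewrite !mulr_ge0 ?invr_ge0 ?(ltW k0).
set b := (c + 3) * k^-1 * E.
have b0 : 0 <= b by rewrite !mulr_ge0 ?invr_ge0 ?(ltW k0)//; lra.
(* As [k <= 12 * sz ^+ 2], [sxi ^+ 2 / k] is at most [12 * u ^+ 2]; hence 288, and 1152 after the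
   factor 4 of [le_capped_powR]. *)
have ub : 24 * (sxi ^+ 2 * L) / k <= 288 * (u ^+ 2 * L).
  rewrite ler_pdivrMr// /u -subr_ge0.
  rewrite [leRHS](_ : _ = 24 * (sxi ^+ 2 * L) * ((12 * sz ^+ 2 - k) / k)).
    by rewrite !mulr_ge0 ?sqr_ge0 ?invr_ge0 ?subr_ge0 ?(ltW k0).
  by field; rewrite gt_eqF.
have Dle : D <= b + 288 * (u ^+ 2 * L).
  rewrite (le_trans _ (lerD (lexx b) ub))// -(ler_pM2l k0) (le_trans kD)//.
  by rewrite /b le_eqVlt; apply/orP; left; apply/eqP; field; rewrite gt_eqF.
have uL0 : 0 <= u ^+ 2 * L by rewrite mulr_ge0 ?sqr_ge0.
have x0 : 0 <= 288 * (u ^+ 2 * L) by exact: (mulr_ge0 (ler0n _ _) uL0).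
have t01 : 0 <= 1 - q / 2 <= 1 by lra.
apply: (le_trans (le_capped_powR _ _ _ _ b0 x0 t01 D4 Dle)); rewrite lerD2l.
rewrite (powRM _ (ler0n _ _) uL0) powRM ?sqr_ge0//.
have -> : (u ^+ 2) `^ (1 - q / 2) = u `^ (2 - q).
  by rewrite -powR_mulrn// -powRrM; congr (_ `^ _); field.
have : (288 : R) `^ (1 - q / 2) <= 288 by rewrite ler1_powR ?ler1n//; lra.
have : L `^ (1 - q / 2) <= E by rewrite EE ler_peMl ?powR_ge0.
move=> hL h288; rewrite (_ : 1152 * _ * E = 4 * (288 * (u `^ (2 - q) * E))); last ring.
rewrite ler_wpM2l// ler_pM ?powR_ge0//.
  by apply: mulr_ge0; exact: powR_ge0.
by rewrite ler_wpM2l ?powR_ge0.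
Qed.

(** Above the level [4 * l / k] the quadratic term dominates; below it, [|x|] factors as
    [|x| ^ (1 - q)] times [|x| ^ q] and the first factor is bounded by the level. *)
Lemma linear_le_sqr_lq_term q k l x : 0 <= q <= 1 -> 0 < k -> 0 < l ->
  2 * l * `|x| <= k / 2 * x ^+ 2 + 2 * l * (4 * l / k) `^ (1 - q) * lq_term q x.
Proof.
move=> /andP[q0 q1] k0 l0; have T0 : 0 < 4 * l / k by rewrite !mulr_gt0 ?invr_gt0.
rewrite -[x ^+ 2]real_normK ?num_real//; set a := `|x|.
have a0 : 0 <= a by exact: normr_ge0.
have [aT|aT] := leP (4 * l / k) a.
  rewrite (@le_trans _ _ (k / 2 * a ^+ 2))//.
    move: aT; rewrite ler_pdivrMr// => aT.
    by rewrite expr2; nra.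
  by rewrite lerDl !mulr_ge0 ?powR_ge0 ?(ltW l0)// lq_term_ge0.
rewrite (@le_trans _ _ (2 * l * (4 * l / k) `^ (1 - q) * lq_term q x))//; last first.
  by rewrite lerDr !mulr_ge0 ?sqr_ge0// ltW.
rewrite -[leRHS]mulrA ler_wpM2l ?mulr_ge0 ?(ltW l0)// /lq_term.
case: eqVneq => [x0|x0]; first by rewrite /a x0 normr0 mulr0.
have an0 : 0 < a by rewrite normr_gt0.
have aE : a = a `^ (1 - q) * a `^ q.
  by rewrite -powRD ?(gt_eqF an0) ?implybT// subrK powRr1.
rewrite {1}aE.
by rewrite ler_wpM2r ?powR_ge0// ge0_ler_powR ?nnegrE ?subr_ge0 ?(ltW T0) ?(ltW aT).
Qed.

(** The linear term is split coordinatewise and its quadratic part absorbed on the left. The level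
    is [T = 72 * u * s]; 10368 is twice the square of 72. *)
Lemma deviation_rate {n : nat} (v : 'cV[R]_n) (dev : 'I_n -> R)
    q k (c E u s L Rq tau : R) :
  0 <= q <= 1 -> 0 < k -> 0 < u -> 0 < s -> s ^+ 2 = L ->
  E = Rq * L `^ (1 - q / 2) -> tau <= c * E -> 0 <= Rq ->
  lq_ball n q (2 * Rq) v -> (forall j, `|dev j| <= 18 * (k * u * s)) ->
  k * l2norm v ^+ 2 - tau <= 2 * (\sum_j dev j * v j 0) + E ->
  l2norm v ^+ 2 <= 2 * (c + 1) * k^-1 * E + 10368 * u `^ (2 - q) * E.
Proof.
move=> q01 k0 u0 s0 sL EE tauE Rq0 vq devle RE.
set l := 18 * (k * u * s) in devle *.
have l0 : 0 < l by rewrite !mulr_gt0.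
set T := 4 * l / k; have TE : T = 72 * u * s by rewrite /T /l; field; rewrite gt_eqF.
have T0 : 0 < T by rewrite TE !mulr_gt0.
have lin : 2 * (\sum_j dev j * v j 0) <=
    k / 2 * l2norm v ^+ 2 + 2 * l * T `^ (1 - q) * (2 * Rq).
  apply: (@le_trans _ _ (\sum_j (k / 2 * v j 0 ^+ 2 +
      2 * l * T `^ (1 - q) * lq_term q (v j 0)))).
    rewrite mulr_sumr; apply: ler_sum => j _.
    apply: le_trans (linear_le_sqr_lq_term _ _ _ _ q01 k0 l0).
    rewrite -mulrA ler_wpM2l// (le_trans (ler_norm _))// normrM.
    by rewrite ler_wpM2r.
  rewrite big_split/= -!mulr_sumr sqr_l2norm lerD2l ler_wpM2l//.
  by rewrite !mulr_ge0 ?powR_ge0// ltW.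
have TT : T `^ (2 - q) = T * T `^ (1 - q).
  rewrite -{2}(powRr1 (ltW T0)) -powRD ?(gt_eqF T0) ?implybT//.
  by congr (_ `^ _); ring.
have Tle : T `^ (2 - q) * Rq <= 5184 * (u `^ (2 - q) * E).
  rewrite TE -mulrA powRM ?mulr_ge0 ?(ltW u0) ?(ltW s0)// powRM ?(ltW u0) ?(ltW s0)//.
  have -> : s `^ (2 - q) = L `^ (1 - q / 2).
    by rewrite -sL -powR_mulrn ?(ltW s0)// -powRrM; congr (_ `^ _); field.
  have h72 : (72 : R) `^ (2 - q) <= 5184.
    rewrite (_ : 5184 = 72 `^ 2%:R); last by rewrite powR_mulrn// -natrX.
    by rewrite ler_powR//; lra.
  rewrite EE -!mulrA (mulrC _ Rq) ler_wpM2r//.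
  by rewrite !mulr_ge0 ?powR_ge0.
have h : k * l2norm v ^+ 2 <= 2 * (c + 1) * E + 8 * l * (T `^ (1 - q) * Rq).
  by move: RE lin tauE; lra.
rewrite -(ler_pM2l k0) (le_trans h)// [leRHS]mulrDr.
have -> : k * (2 * (c + 1) * k^-1 * E) = 2 * (c + 1) * E.
  by field; rewrite gt_eqF.
rewrite lerD2l.
have -> : 8 * l * (T `^ (1 - q) * Rq) = 2 * k * (T `^ (2 - q) * Rq).
  by rewrite TT /T; field; rewrite gt_eqF.
rewrite [leRHS](_ : _ = 2 * k * (5184 * (u `^ (2 - q) * E))); last by ring.
by rewrite ler_wpM2l// mulr_ge0// ltW.
Qed.

End rate.

(** * Measurability of the estimator *)

Section countable_dense_subset.
Context {R : realType} {n : nat}.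
Implicit Types (A : set 'cV[R]_n) (b : 'cV[R]_n).

Definition dense_sequence A (u : nat -> 'cV[R]_n) : Prop :=
  (forall k, A (u k)) /\
  forall b, A b -> forall e : R, 0 < e -> exists k, forall j, `|b j 0 - u k j 0| < e.

(** Boxes with rational centre and radius [1 / (N + 1)] are enumerated, and a point of [A] is chosen
    in each box that meets [A]; that point need not be rational. *)
Lemma ex_dense_sequence A b0 : A b0 -> exists u, dense_sequence A u.
Proof.
move=> Ab0.
pose box (p : 'cV[rat]_n * nat) := [set b | A b /\
  forall j, `|b j 0 - ratr (p.1 j 0)| < p.2.+1%:R^-1].
(* The point [b0] is the default for invalid codes and for boxes that miss [A]. *)
exists (fun k => if unpickle k is Some p then xget b0 (box p) else b0); split.
  by move=> k; case: unpickle => // p; case: xgetP => // b _ [].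
move=> b Ab e e0.
(* Two points of one box differ by less than [2 / (N + 1)], which is below [e]. *)
pose N := Num.trunc (2 / e).
have N0 : (0 : R) < N.+1%:R^-1 by rewrite invr_gt0.
have Ne : 2 * N.+1%:R^-1 < e.
  by rewrite ltr_pdivrMr ?ltr0n// mulrC -ltr_pdivrMr// truncnS_gt.
have ex j : exists r : rat, `|b j 0 - ratr r| < N.+1%:R^-1.
  have [|r] := @rat_in_itvoo R (b j 0 - N.+1%:R^-1) (b j 0 + N.+1%:R^-1).
    by rewrite ltrD2l (lt_trans _ N0)// oppr_lt0.
  by rewrite in_itv/= => rP; exists r; rewrite ltr_distlC.
have [r rP] := boolp.choice ex.
pose p : 'cV[rat]_n * nat := (\col_j r j, N).
have bp : box p b by split => // j; rewrite mxE.
exists (pickle p) => j; rewrite pickleK; have [_ /(_ j)] := xgetPex b0 (ex_intro _ _ bp).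
rewrite distrC => h2; have h1 := bp.2 j.
rewrite (le_lt_trans (ler_distD (ratr (p.1 j 0)) _ _))// (lt_trans _ Ne)//.
by rewrite mulr_natl mulr2n ltrD.
Qed.

Lemma dense_sequence_approx A u (f : 'cV[R]_n -> R) b (e : R) :
  dense_sequence A u -> continuous f -> A b -> 0 < e ->
  exists k, `|f b - f (u k)| < e.
Proof.
move=> [_ uA] cf Ab e0.
have /cvgrPdist_lt /(_ e e0) /nbhs_ballP[d d0 hd] := cf b.
have [k kP] := uA b Ab d d0.
exists k; apply: hd; split=> // i j; rewrite ord1; exact: kP.
Qed.

End countable_dense_subset.

Section polynomial_regularity.
Context {R : realType} {m n : nat}.

Lemma continuous_sum_cond {T : topologicalType} {I : Type} (r : seq I) (Q : pred I)
    (F : I -> T -> R) : (forall i, Q i -> continuous (F i)) ->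
  continuous (fun x => \sum_(i <- r | Q i) F i x).
Proof. by apply: continuous_big => x; exact: add_continuous. Qed.

Lemma continuous_sqr {T : topologicalType} (F : T -> R) :
  continuous F -> continuous (fun x => F x ^+ 2).
Proof. by move=> cF x; under eq_fun do rewrite expr2; apply: cvgM; exact: cF. Qed.

Lemma continuous_sqr_norm : continuous (fun b : 'cV[R]_n => l2norm b ^+ 2).
Proof.
under eq_fun do rewrite sqr_l2norm; apply: continuous_sum_cond => j _.
by apply: continuous_sqr; exact: coord_continuous.
Qed.

Lemma continuous_mulmx_entry (Z : 'M[R]_(m, n)) i :
  continuous (fun b : 'cV[R]_n => (Z *m b) i 0).
Proof.
under eq_fun do rewrite mxE; apply: continuous_sum_cond => j _ b.
exact: (cvgM (cvg_cst (Z i j)) (@coord_continuous R n 1 j 0 b)).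
Qed.

Lemma continuous_sqr_loss (y : 'cV[R]_m) (Z : 'M[R]_(m, n)) :
  continuous (sqr_loss y Z).
Proof.
have c : continuous (fun b : 'cV[R]_n => \sum_i (y i 0 - (Z *m b) i 0) ^+ 2).
  apply: continuous_sum_cond => i _; apply: continuous_sqr => b.
  exact: (cvgB (cvg_cst (y i 0)) (continuous_mulmx_entry Z i b)).
by move=> b; exact: (cvgM (cvg_cst _) (c b)).
Qed.

Lemma continuous_Gamma_hat_form s (Z : 'M[R]_(m, n)) :
  continuous (fun b : 'cV[R]_n => (b^T *m Gamma_hat s Z *m b) 0 0).
Proof.
have c : continuous (fun b : 'cV[R]_n => \sum_i (Z *m b) i 0 ^+ 2).
  by apply: continuous_sum_cond => i _; apply: continuous_sqr; exact: continuous_mulmx_entry.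
under eq_fun do rewrite Gamma_hat_form.
move=> b; exact: (cvgB (cvgM (cvg_cst _) (c b))
  (cvgM (cvg_cst _) (continuous_sqr_norm b))).
Qed.

End polynomial_regularity.

(** * Measurability of the restricted eigenvalue event and of the near-minimiser *)

Section measurable_selection.
Context {R : realType} {m n : nat}.
Local Notation data := ('cV[R]_m * 'M[R]_(m, n))%type.

Lemma measurable_sqr_loss (b : 'cV[R]_n) :
  measurable_fun setT (fun p : data => sqr_loss p.1 p.2 b).
Proof.
apply: measurable_funM => //; apply: measurable_sum => i.
apply: measurable_funX; apply: measurable_funB.
  exact: (measurableT_comp (measurable_entry i 0) measurable_fst).
under eq_fun do rewrite mxE; apply: measurable_sum => j.
apply: measurable_funM => //.
exact: (measurableT_comp (measurable_entry i j) measurable_snd).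
Qed.

Lemma measurable_Gamma_hat_form s (b : 'cV[R]_n) :
  measurable_fun setT (fun Z : 'M[R]_(m, n) => (b^T *m Gamma_hat s Z *m b) 0 0).
Proof.
under eq_fun do rewrite Gamma_hat_form; apply: measurable_funB => //.
apply: measurable_funM => //; apply: measurable_sum => i; apply: measurable_funX.
under eq_fun do rewrite mxE; apply: measurable_sum => j.
by apply: measurable_funM => //; exact: measurable_entry.
Qed.

(** Both sides of the condition are continuous in [b], so a countable intersection over a dense
    sequence of the ball suffices. *)
Lemma measurable_restricted_eigenvalue q r kappa tau s : 0 < r ->
  measurable [set Z : 'M[R]_(m, n) |
    restricted_eigenvalue q r kappa tau (Gamma_hat s Z)].
Proof.
move=> r0; have lq0 : lq_ball n q r 0.
  rewrite /lq_ball/= big1 ?ltW// => j _; by rewrite mxE eqxx.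
have [u [uA ud]] := ex_dense_sequence _ _ lq0.
pose h (Z : 'M[R]_(m, n)) (b : 'cV[R]_n) := (b^T *m Gamma_hat s Z *m b) 0 0 - kappa * l2norm b ^+ 2.
have ch Z : continuous (h Z).
  move=> b; exact: (cvgB (continuous_Gamma_hat_form s Z b)
    (cvgM (cvg_cst _) (continuous_sqr_norm b))).
rewrite [X in measurable X](_ : _ = \bigcap_k [set Z | - tau <= h Z (u k)]).
  apply: bigcapT_measurable => k; rewrite -[X in measurable X]setTI.
  apply: measurable_fun_ler => //; apply: measurable_funB => //.
  exact: measurable_Gamma_hat_form.
apply/seteqP; split=> [Z RE k _|Z RE b bA] /=.
  by have := RE _ (uA k); rewrite /h; lra.
suff : - tau <= h Z b by rewrite /h; lra.
rewrite leNgt; apply/negP => lt.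
have e0 : 0 < - tau - h Z b by rewrite subr_gt0.
have [k] := dense_sequence_approx _ _ _ _ _ (conj uA ud) (ch Z) bA e0.
by rewrite ltr_distlC => /andP[_]; have := RE k I; rewrite /=; lra.
Qed.

(* [argmin_index p] is the first index of an [eps]-minimiser of the loss among
   the [u k] (and [0] if there is none). *)
Context (u : nat -> 'cV[R]_n) (eps : R).

Definition near_min (p : data) (k : nat) : Prop :=
  forall l, sqr_loss p.1 p.2 (u k) <= sqr_loss p.1 p.2 (u l) + eps.

Definition first_near_min (p : data) (k : nat) : Prop :=
  near_min p k /\ forall l, (l < k)%N -> ~ near_min p l.

Definition argmin_index (p : data) : nat := xget 0%N (first_near_min p).

(** The loss is bounded below by 0, so a positive tolerance is met near its infimum, and a least
    such index exists. *)
Lemma argmin_indexP p : 0 < eps -> near_min p (argmin_index p).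
Proof.
move=> eps0; have [k kP] : exists k, near_min p k.
  pose E := range (fun k => sqr_loss p.1 p.2 (u k)).
  have lb : has_lbound E.
    exists 0 => _ [k _ <-]; rewrite mulr_ge0 ?invr_ge0// sumr_ge0// => i _.
    exact: sqr_ge0.
  have iE : has_inf E by split => //; exists (sqr_loss p.1 p.2 (u 0%N)); exists 0%N.
  have [_ [k _ <-] kE] := inf_adherent eps0 iE.
  exists k => l; rewrite (le_trans (ltW kE))// lerD2r ge_inf//.
  by exists l.
have ex : exists k, `[< near_min p k >] by exists k; apply/asboolP.
case: (ex_minnP ex) => k0 /asboolP k0P k0min.
have : first_near_min p (argmin_index p).
  apply: (xgetPex 0%N); exists k0; split=> // l lk lP.
  by have := k0min l; rewrite leqNgt lk => /(_ (asboolT lP)).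
by case.
Qed.

Lemma measurable_argmin_index : measurable_fun setT argmin_index.
Proof.
have mnear k : measurable [set p | near_min p k].
  rewrite [X in measurable X](_ : _ = \bigcap_l
      [set p : data | sqr_loss p.1 p.2 (u k) <= sqr_loss p.1 p.2 (u l) + eps]).
    apply: bigcapT_measurable => l; rewrite -[X in measurable X]setTI.
    apply: measurable_fun_ler => //; first exact: measurable_sqr_loss.
    by apply: measurable_funD => //; exact: measurable_sqr_loss.
  by apply/seteqP; split=> [p h l _|p h l]; [exact: h|exact: (h l I)].
have mfirst k : measurable [set p | first_near_min p k].
  rewrite [X in measurable X](_ : _ = [set p | near_min p k] `&`
      \bigcap_l (if (l < k)%N then ~` [set p | near_min p l] else setT)).
    apply: measurableI => //; apply: bigcapT_measurable => l.
    by case: ifP => // _; exact: measurableC.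
  apply/seteqP; split=> [p [h1 h2]|p [h1 h2]]; split=> //.
    by move=> l _ /=; case: ifP => // lk; exact: h2.
  by move=> l lk; have := h2 l I; rewrite lk.
(* The value 0 is also the default of [xget], so its level set includes the data without
   near-minimiser. *)
have mindex k : measurable [set p | argmin_index p = k].
  rewrite [X in measurable X](_ : _ = [set p | first_near_min p k] `|`
      (if k == 0%N then ~` \bigcup_l [set p | first_near_min p l] else set0)).
    apply: measurableU => //; case: ifP => // _; apply: measurableC.
    exact: bigcupT_measurable.
  apply/seteqP; split=> p /=.
    rewrite /argmin_index; case: xgetP => [l _ lP <-|none <-]; first by left.
    by right; rewrite eqxx => -[l _ /none].
  rewrite /argmin_index; case: xgetP => [l _ lP|none].
    case=> [kP|]; last by case: ifP => // _; case; exists l.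
    case: (ltngtP l k) => // lk; [case: (kP.2 l lk)|case: (lP.2 k lk)].
      exact: lP.1.
    exact: kP.1.
  by case=> [/none//|]; case: eqP.
move=> _ B _; rewrite setTI.
rewrite [X in measurable X](_ : _ =
    \bigcup_k (if k \in B then [set p | argmin_index p = k] else set0)).
  by apply: bigcupT_measurable => k; case: ifP.
apply/seteqP; split=> p /=.
  by move=> Bp; exists (argmin_index p) => //; rewrite mem_set.
by move=> [k _]; case: ifPn => // /set_mem kB kE; rewrite /preimage kE.
Qed.

Lemma measurable_argmin : measurable_fun setT (u \o argmin_index).
Proof. by apply: measurableT_comp => //; exact: measurable_argmin_index. Qed.

End measurable_selection.

(** Common bookkeeping for the three regimes of the error bound: each has its own constants [a] and
    [b], both below [C]. *)
Lemma rate_combine {R : realType} (C a b c D x x' z : R) : 0 <= c ->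
  0 <= x' <= x -> 0 <= z -> 0 <= b <= C -> a <= C ->
  D <= a * (c + 1) * z + b * x' -> D <= C * ((1 + c) * (x + z)).
Proof.
move=> c0 /andP[x'0 x'x] z0 /andP[b0 bC] aC Dle; have C0 := le_trans b0 bC.
have x0 := le_trans x'0 x'x; have c10 : 0 <= c + 1 by rewrite addr_ge0.
rewrite (le_trans Dle)// [leRHS](_ : _ = C * (c + 1) * z + C * ((c + 1) * x)); last first.
  by ring.
rewrite lerD//; first by rewrite !ler_wpM2r.
rewrite (le_trans (ler_pM b0 x'0 bC x'x))// ler_wpM2l// ler_peMl//.
by rewrite lerDr.
Qed.

(** * Error bound on the good event *)

Section error_bound.
Context {R : realType} {m n : nat}.
Context {y : 'cV[R]_m} {Z : 'M[R]_(m, n)} {xi : 'I_m -> R} {bs bh : 'cV[R]_n}.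
Context {q kappa tau c E L Rq sw sz sxi sn delta : R}.
Hypotheses (m0 : (0 < m)%N) (n0 : (0 < n)%N) (q01 : 0 <= q <= 1).
Hypotheses (kappa0 : 0 < kappa) (L0 : 0 < L) (c0 : 0 <= c).
Hypotheses (sz0 : 0 <= sz) (sxi0 : 0 <= sxi) (sxin : sxi <= sn).
Hypotheses (EE : E = Rq * L `^ (1 - q / 2)) (tauE : tau <= c * E).
Hypothesis yE : forall i, y i 0 = (Z *m bs) i 0 + xi i.
Hypothesis loss_le : sqr_loss y Z bh <= sqr_loss y Z bs + E.
Hypotheses (bsq : lq_ball n q Rq bs) (bs1 : l2sphere n bs).
Hypotheses (bhq : lq_ball n q Rq bh) (bh1 : l2sphere n bh).
Hypothesis RE : restricted_eigenvalue q (2 * Rq) kappa tau (Gamma_hat sw Z).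
Hypothesis dE : delta * (24 * (L + 1)) = E.
Hypothesis noise_le :
  \sum_i xi i ^+ 2 <= 4 * m%:R * (sxi ^+ 2 + delta) * (1 / 2 + L).
Hypothesis entries_le :
  \sum_i \sum_j Z i j ^+ 2 <= 6 * (m%:R * n%:R) * (sz ^+ 2 + delta).
Hypothesis deviation_le : L < 1 -> 0 < sz * sxi -> forall j,
  `|m%:R^-1 * (\sum_i Z i j * xi i) + sw ^+ 2 * bs j 0| <=
  18 * (sz * sxi * Num.sqrt L).

Lemma error_bound (C : R) : 8 <= C -> 10368 <= C ->
  l2norm (bh - bs) ^+ 2 <= C * (1 + c) *
  ((sz `^ (2 - q) * sn `^ (2 - q) + kappa `^ (1 - q)) / kappa `^ (2 - q)) *
  Rq * L `^ (1 - q / 2).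
Proof.
move=> C8; have [q0 q1] := andP q01.
have mR : 0 < m%:R :> R by rewrite ltr0n.
have nR : 0 < n%:R :> R by rewrite ltr0n.
have Rq1 : 1 <= Rq := lq_sphere_radius_ge1 _ _ _ q01 bsq bs1.
have E0 : 0 < E by rewrite EE mulr_gt0 ?powR_gt0//; lra.
have L10 : 0 < 24 * (L + 1) by rewrite mulr_gt0// addr_gt0.
have d0 : 0 < delta by move: E0; rewrite -dE pmulr_lgt0.
have dL0 : 0 < delta * L by rewrite mulr_gt0.
have ki0 : 0 < kappa^-1 by rewrite invr_gt0.
rewrite rate_split// ?(le_trans sxi0)//.
set w := (sz * sn / kappa) `^ (2 - q).
rewrite [X in _ -> _ <= X](_ : _ = C * ((1 + c) * (w * E + kappa^-1 * E))); last first.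
  by rewrite EE; ring.
have w0 : 0 <= w by exact: powR_ge0.
set D := l2norm _ ^+ 2.
have D4 : D <= 4 := sqr_l2norm_sphereB_le bs1 bh1.
have wle : (sz * sxi / kappa) `^ (2 - q) <= w.
  have sn0 := le_trans sxi0 sxin; have ki := ltW ki0.
  apply: ge0_ler_powR; rewrite ?nnegrE ?mulr_ge0//; first by lra.
  by rewrite ler_wpM2r// ler_wpM2l.
have cE0 : 0 <= c * E by rewrite mulr_ge0// ltW.
have kE0 : 0 < kappa^-1 * E by rewrite mulr_gt0.
have ckE0 : 0 <= c * (kappa^-1 * E) by rewrite mulr_ge0// ltW.
have wE0 : 0 <= w * E by rewrite mulr_ge0// ltW.
have w'E : 0 <= (sz * sxi / kappa) `^ (2 - q) * E <= w * E.
  by rewrite mulr_ge0 ?powR_ge0 ?(ltW E0)//= ler_wpM2r// ltW.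
(* In this first regime the claimed bound is at least 4, the maximal squared distance on the
   sphere. *)
have [kE|kE] := leP kappa (2 * (c + 1) * E).
  move=> _; have h : 1 <= 2 * (c * (kappa^-1 * E) + kappa^-1 * E).
    rewrite -(ler_pM2l kappa0) mulr1 (le_trans kE)// le_eqVlt; apply/orP; left.
    by apply/eqP; field; rewrite gt_eqF.
  apply: (rate_combine C 8 0 c D (w * E) 0 (kappa^-1 * E)); rewrite ?lexx ?(ltW kE0)//=.
    by rewrite (le_trans _ C8).
  by lra.
(* Here [kappa <= 6 * sz ^+ 2 + (c + 1) * E], and the last term is less than half of [kappa]. *)
have k12 : kappa <= 12 * sz ^+ 2.
  have Rq2 : 1 <= 2 * Rq by lra.
  have avg := restricted_eigenvalue_average _ _ _ _ _ _ n0 Rq2 RE.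
  have : kappa - tau <= 6 * (sz ^+ 2 + delta).
    rewrite (le_trans avg)// ler_pdivrMl ?mulr_gt0// (le_trans entries_le)//.
    by rewrite le_eqVlt; apply/orP; left; apply/eqP; ring.
  have : 6 * delta <= E by move: dE; lra.
  by move: tauE; lra.
have sz_gt0 : 0 < sz.
  rewrite lt_neqAle sz0 andbT; apply/eqP => z0.
  by move: k12; rewrite -z0 expr0n mulr0 leNgt kappa0.
have vq : lq_ball n q (2 * Rq) (bh - bs) by exact: lq_ballB.
have REv := RE _ vq.
(* The cross moments are controlled only if [L < 1] and the noise is nondegenerate; otherwise the
   cruder noise bound applies. *)
have [/andP[L1 sxi_gt0]|noise] := boolP ((L < 1) && (0 < sxi)).
  have u0 : 0 < sz * sxi by rewrite mulr_gt0.
  have dev := deviation_le L1 u0.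
  have sL : Num.sqrt L ^+ 2 = L by rewrite sqr_sqrtr// ltW.
  have sL0 : 0 < Num.sqrt L by rewrite sqrtr_gt0.
  have uk0 : 0 < sz * sxi / kappa by rewrite mulr_gt0.
  have devk j : `|m%:R^-1 * (\sum_i Z i j * xi i) + sw ^+ 2 * bs j 0| <=
      18 * (kappa * (sz * sxi / kappa) * Num.sqrt L).
    by rewrite [kappa * _]mulrC divfK ?gt_eqF//; exact: dev.
  have Rq0 : 0 <= Rq by lra.
  have h := deviation_rate _ _ _ _ _ _ _ _ _ _ _ q01 kappa0 uk0 sL0 sL EE tauE Rq0 vq devk
    (le_trans REv (Gamma_hat_deviation yE loss_le bs1 bh1 sw)).
  move=> CK; apply: (rate_combine C 2 10368 c D _ _ _ c0 w'E (ltW kE0)).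
  - by rewrite CK ler0n.
  - by rewrite (le_trans _ C8)// ler_nat.
  - by rewrite !mulrA; exact: h.
have sL : sxi = 0 \/ 1 <= L.
  move: noise; rewrite negb_and -!leNgt => /orP[|s0]; [by right|left].
  by apply/eqP; rewrite eq_le s0 sxi0.
have := le_trans REv (Gamma_hat_noise yE loss_le sw).
rewrite -/D => REn.
have mean_le : m%:R^-1 * \sum_i xi i ^+ 2 <= 4 * (sxi ^+ 2 + delta) * (1 / 2 + L).
  rewrite ler_pdivrMl// (le_trans noise_le)// le_eqVlt; apply/orP; left.
  by apply/eqP; ring.
have dL : 16 * delta * (1 / 2 + L) <= E by move: dE; lra.
(* For [L >= 1], [8 + 16 * L <= 24 * L]; for [sxi = 0] both sides vanish. *)
have sxiL : 16 * sxi ^+ 2 * (1 / 2 + L) <= 24 * (sxi ^+ 2 * L).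
  case: sL => [->|L1]; first by rewrite expr0n/= !(mul0r, mulr0).
  by have := sqr_ge0 sxi; nra.
have kD : kappa * D <= (c + 3) * E + 24 * (sxi ^+ 2 * L).
  by move: tauE mean_le dL sxiL REn; lra.
have c3 : c + 3 <= 3 * (c + 1) by move: c0; lra.
have h := noise_rate _ _ _ _ _ _ _ _ _ q01 kappa0 c0 (ltW L0) Rq1 sz0 sxi0 EE k12 D4 kD.
move=> CK; apply: (rate_combine C 3 1152 c D _ _ _ c0 w'E (ltW kE0)).
- by rewrite ler0n (le_trans _ CK)// ler_nat.
- by rewrite (le_trans _ C8)// ler_nat.
rewrite (le_trans h)// !mulrA lerD2r -!(mulrA _ kappa^-1) ler_wpM2r ?(ltW kE0)//.
Qed.

End error_bound.

(** * The exceptional events *)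

Section union_bound.
Context {R : realType} {d : measure_display} {T : measurableType d}.
Context (P : probability T R).

Lemma finite_union_bound {I : finType} (F : set T) (A : I -> set T) :
  measurable F -> (forall i, measurable (A i)) ->
  (forall t, F t -> exists i, A i t) -> (P F <= \sum_i P (A i))%E.
Proof.
move=> mF mA FA.
have ub (s : seq I) : (P (\big[setU/set0]_(i <- s) A i) <= \sum_(i <- s) P (A i))%E.
  elim: s => [|i s ih]; first by rewrite !big_nil measure0.
  rewrite !big_cons (le_trans (measureU2 _ _ _))//; last by rewrite leeD2l.
  by apply: bigsetU_measurable.
apply: le_trans (ub (index_enum I)); apply: le_measure; rewrite ?inE//.
  by apply: bigsetU_measurable.
by move=> t /FA[i Ait]; rewrite -bigcup_seq; exists i => //=; rewrite mem_index_enum.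
Qed.

Lemma measurable_gt (c : R) (f : T -> R) :
  measurable_fun setT f -> measurable [set t | c < f t].
Proof.
move=> mf; rewrite -[X in measurable X]setTI.
by apply: measurable_fun_ltr.
Qed.

End union_bound.

(** * Tails of the residual and of the cross moments *)

Section tail_events.
Context {R : realType} {d : measure_display} {T : measurableType d}.
Context {P : probability T R} {m n : nat} {sx sw se : R}.
Context {X W : 'I_m -> {RV P >-> 'rV[R]_n}} {e : 'I_m -> {RV P >-> R}}.
Context {bs : 'cV[R]_n}.
Hypothesis setting : additive_error_setting sx sw se X W e.
Hypothesis bs1 : l2sphere n bs.

Definition residual (bs : 'cV[R]_n) (W : 'I_m -> {RV P >-> 'rV[R]_n})
  (e : 'I_m -> {RV P >-> R}) i t : R := e i t - \sum_j bs j 0 * W i t 0 j.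

Local Notation xi := (residual bs W e).
Local Notation Z t := (observed_Z X W t).

Lemma observed_yE i t : observed_y bs X e t i 0 = (Z t *m bs) i 0 + xi i t.
Proof.
rewrite !mxE /residual.
have -> : \sum_j observed_Z X W t i j * bs j 0 =
    \sum_j X i t 0 j * bs j 0 + \sum_j bs j 0 * W i t 0 j.
  by rewrite -big_split/=; apply: eq_bigr => j _; rewrite !mxE; ring.
by ring.
Qed.

Lemma observed_ZE i j t : Z t i j = X i t 0 j + W i t 0 j.
Proof. by rewrite !mxE. Qed.

Lemma measurable_observed_Z : measurable_fun setT (fun t => Z t).
Proof.
apply: measurable_to_matrix => i j; under eq_fun do rewrite observed_ZE.
have ind := (independent_scalars _ _ _ _ _ _ _ setting).1.
by apply: measurable_funD; [exact: (ind (inl (inl (i, j))))|exact: (ind (inl (inr (i, j))))].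
Qed.

Lemma measurable_residual i : measurable_fun setT (xi i).
Proof.
have ind := (independent_scalars _ _ _ _ _ _ _ setting).1.
apply: measurable_funB; first exact: (ind (inr i)).
apply: measurable_sum => j; apply: measurable_funM => //.
exact: (ind (inl (inr (i, j)))).
Qed.

Lemma measurable_observed_y : measurable_fun setT (observed_y bs X e).
Proof.
apply: measurable_to_matrix => i j; rewrite ord1.
under eq_fun do rewrite observed_yE; apply: measurable_funD; last exact: measurable_residual.
under eq_fun do rewrite mxE; apply: measurable_sum => k; apply: measurable_funM => //.
exact: (measurableT_comp (measurable_entry i k) measurable_observed_Z).
Qed.

Let sq1 : \sum_j bs j 0 ^+ 2 = 1.
Proof. by rewrite -sqr_l2norm bs1 expr1n. Qed.

(** The residual is the row form with coefficients 0 on [X], [- bs] on [W] and 1 on [e]; its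
    variance is explicit because [bs] is a unit vector. *)
Lemma residual_tail (V r : R) : sw ^+ 2 + se ^+ 2 <= V -> 0 < V ->
  (P [set t | m%:R * (1 / 4) * (sw ^+ 2 + se ^+ 2) +
              V * (4 * m%:R * (1 / 4) ^+ 2 + r) <
      1 / 4 * \sum_i xi i t ^+ 2]%R <= (expR (- r))%:E)%E.
Proof.
move=> vV V0; have th4 : `|1 / 4 : R| <= 1 / 4 by rewrite ger0_norm.
have vE : sw ^+ 2 + se ^+ 2 = \sum_(j < n) (0 : R) ^+ 2 * sx ^+ 2 +
    \sum_j (- bs j 0) ^+ 2 * sw ^+ 2 + 1 ^+ 2 * se ^+ 2.
  rewrite big1 => [|j _]; last by rewrite expr0n mul0r.
  by rewrite -mulr_suml; under eq_bigr do rewrite sqrrN; rewrite sq1; ring.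
have := row_form_tail setting _ _ _ _ _ _ r vE vV V0 th4.
congr (P _ <= _)%E; apply/funext => t; congr (is_true (_ < _ * _)).
apply: eq_bigr => i _; congr (_ ^+ 2); rewrite /residual big1 => [|j _]; last first.
  by rewrite mul0r.
rewrite add0r mul1r addrC; congr (_ + _); rewrite -sumrN.
by apply: eq_bigr => j _; rewrite mulNr.
Qed.

Context {sz sxi : R}.
Hypotheses (szE : sz ^+ 2 = sx ^+ 2 + sw ^+ 2) (sxiE : sxi ^+ 2 = sw ^+ 2 + se ^+ 2).
Hypotheses (szxi0 : 0 < sz * sxi).

(* Polarisation: the difference of these variables for [s = 1] and [s = -1]
   is a multiple of the deviation of the empirical cross moment. *)
Lemma cross_tail j (s th r : R) : s ^+ 2 = 1 -> `|th| <= 1 / 4 ->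
  (P [set t | m%:R * th * (2 * (sz * sxi) * (sz * sxi - s * (sw ^+ 2 * bs j 0))) +
              4 * (sz * sxi) ^+ 2 * (4 * m%:R * th ^+ 2 + r) <
      th * \sum_i (sxi * Z t i j + s * sz * xi i t) ^+ 2]%R <= (expR (- r))%:E)%E.
Proof.
move=> s2 th4.
(* Coefficients of [sxi * Z i j + s * sz * xi i] in the independent scalars. The weights give both
   summands the variance [(sz * sxi) ^+ 2]. *)
pose aX k : R := sxi * (k == j)%:R.
pose aW k : R := sxi * (k == j)%:R - s * sz * bs k 0.
have sumj (F : 'I_n -> R) : \sum_k (k == j)%:R * F k = F j.
  rewrite (bigD1 j)//= eqxx mul1r big1 ?addr0// => k /negbTE ->.
  by rewrite mul0r.
have vE : 2 * (sz * sxi) * (sz * sxi - s * (sw ^+ 2 * bs j 0)) =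
    \sum_k aX k ^+ 2 * sx ^+ 2 + \sum_k aW k ^+ 2 * sw ^+ 2 +
    (s * sz) ^+ 2 * se ^+ 2.
  have -> : \sum_k aX k ^+ 2 * sx ^+ 2 = sxi ^+ 2 * sx ^+ 2.
    rewrite -[RHS](sumj (fun=> sxi ^+ 2 * sx ^+ 2)); apply: eq_bigr => k _; rewrite /aX.
    by case: eqP => _ /=; ring.
  have -> : \sum_k aW k ^+ 2 * sw ^+ 2 =
      (sxi ^+ 2 - 2 * sxi * s * sz * bs j 0 + sz ^+ 2) * sw ^+ 2.
    rewrite -mulr_suml; congr (_ * _).
    transitivity (\sum_k ((k == j)%:R * (sxi ^+ 2 - 2 * sxi * s * sz * bs k 0) +
        sz ^+ 2 * bs k 0 ^+ 2)).
      apply: eq_bigr => k _; rewrite /aW.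
      transitivity ((sxi * (k == j)%:R) ^+ 2 - 2 * sxi * (k == j)%:R * s * sz * bs k 0 +
         s ^+ 2 * (sz ^+ 2 * bs k 0 ^+ 2)); first by ring.
      by rewrite s2; case: eqP => _ /=; ring.
    by rewrite big_split/= sumj -mulr_sumr sq1 mulr1.
  rewrite exprMn s2.
  have -> : 2 * (sz * sxi) * (sz * sxi - s * (sw ^+ 2 * bs j 0)) =
    sz ^+ 2 * sxi ^+ 2 + sxi ^+ 2 * sz ^+ 2 - 2 * sxi * s * sz * bs j 0 * sw ^+ 2.
    by ring.
  by rewrite {1}sxiE {2}szE; ring.
have V0 : 0 < 4 * (sz * sxi) ^+ 2 by rewrite mulr_gt0// exprn_gt0.
have bj1 : bs j 0 ^+ 2 <= 1.
  by rewrite -sq1 (bigD1 j)//= lerDl sumr_ge0// => k _; exact: sqr_ge0.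
(* Comparing squares, [sw ^+ 4] is at most [(sx ^+ 2 + sw ^+ 2) * (sw ^+ 2 + se ^+ 2)]; this bounds
   the covariance term of the variance. *)
have swle : sw ^+ 2 <= sz * sxi.
  rewrite -(@ler_pXn2r _ 2)// ?nnegrE ?sqr_ge0 ?(ltW szxi0)// [(sz * sxi) ^+ 2]exprMn szE sxiE.
  have := sqr_ge0 sx; have := sqr_ge0 sw; have := sqr_ge0 se.
  by move=> *; rewrite [leLHS]expr2 ler_pM ?sqr_ge0// ?lerDl ?lerDr.
have vV : 2 * (sz * sxi) * (sz * sxi - s * (sw ^+ 2 * bs j 0)) <= 4 * (sz * sxi) ^+ 2.
  have h : - (s * (sw ^+ 2 * bs j 0)) <= sz * sxi.
    rewrite (le_trans (ler_norm _))// normrN -(@ler_pXn2r _ 2)// ?nnegrE ?(ltW szxi0)//.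
    rewrite real_normK ?num_real// exprMn s2 mul1r exprMn.
    rewrite (@le_trans _ _ ((sw ^+ 2) ^+ 2))// ?ler_piMr ?sqr_ge0//.
    by rewrite ler_pXn2r ?nnegrE ?sqr_ge0 ?(ltW szxi0).
  by have := ler_wpM2l (ltW szxi0) h; lra.
have := row_form_tail setting _ _ _ _ _ _ r vE vV V0 th4.
congr (P _ <= _)%E; apply/funext => t; congr (is_true (_ < _ * _)).
apply: eq_bigr => i _; congr (_ ^+ 2); rewrite /residual observed_ZE.
have -> : \sum_k aX k * X i t 0 k = sxi * X i t 0 j.
  rewrite -(sumj (fun k => X i t 0 k)) mulr_sumr.
  by apply: eq_bigr => k _; rewrite mulrA.
have -> : \sum_k aW k * W i t 0 k =
    sxi * W i t 0 j - s * sz * \sum_k bs k 0 * W i t 0 k.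
  rewrite -(sumj (fun k => W i t 0 k)) !mulr_sumr -sumrB.
  by apply: eq_bigr => k _; rewrite /aW; ring.
by ring.
Qed.

End tail_events.

(** The sums for [s = 1] and [s = -1] differ by [4 * a * b] times the cross sum. Opposite signs of
    [th] for the two give one side each; 18 is [8 * (4 / 16 + 2)]. *)
Lemma cross_deviation {R : realType} {m : nat} (z x : 'I_m -> R) (a b w L : R) :
  (0 < m)%N -> 0 < a -> 0 < b -> 0 < L ->
  (forall s th, s ^+ 2 = 1 -> th ^+ 2 = (Num.sqrt L / 4) ^+ 2 ->
    th * \sum_i (b * z i + s * a * x i) ^+ 2 <=
    m%:R * th * (2 * (a * b) * (a * b - s * w)) +
    4 * (a * b) ^+ 2 * (4 * m%:R * th ^+ 2 + 2 * (m%:R * L))) ->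
  `|m%:R^-1 * (\sum_i z i * x i) + w| <= 18 * (a * b * Num.sqrt L).
Proof.
move=> m0 a0 b0 L0 h; set S := \sum_i z i * x i.
have mR : 0 < m%:R :> R by rewrite ltr0n.
set l := Num.sqrt L; have l0 : 0 < l by rewrite sqrtr_gt0.
have lL : L = l ^+ 2 by rewrite sqr_sqrtr// ltW.
have ab0 : 0 < a * b by rewrite mulr_gt0.
pose Q s := \sum_i (b * z i + s * a * x i) ^+ 2.
have QE : Q 1 - Q (-1) = 4 * (a * b) * S.
  rewrite /Q -sumrB mulr_sumr; apply: eq_bigr => i _; ring.
have one : (1 : R) ^+ 2 = 1 by rewrite expr1n.
have mone : (-1 : R) ^+ 2 = 1 by rewrite sqrrN.
have tl : (l / 4) ^+ 2 = (l / 4) ^+ 2 by [].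
have tNl : (- (l / 4)) ^+ 2 = (l / 4) ^+ 2 by rewrite sqrrN.
have h1 := h 1 _ one tl; have h2 := h 1 _ one tNl.
have h3 := h (-1) _ mone tl; have h4 := h (-1) _ mone tNl.
have K : 0 < l * (a * b) by rewrite mulr_gt0.
have up : l * (a * b) * (S + m%:R * w) <= l * (a * b) * (18 * (m%:R * (a * b * l))).
  move: h1 h4; rewrite -!/(Q _) lL.
  have -> : l * (a * b) * (S + m%:R * w) = l / 4 * (Q 1 - Q (-1)) + l * (a * b) * (m%:R * w).
    by rewrite QE; field.
  by lra.
have lo : - (l * (a * b) * (18 * (m%:R * (a * b * l)))) <= l * (a * b) * (S + m%:R * w).
  move: h2 h3; rewrite -!/(Q _) lL.
  have -> : l * (a * b) * (S + m%:R * w) = l / 4 * (Q 1 - Q (-1)) + l * (a * b) * (m%:R * w).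
    by rewrite QE; field.
  by lra.
have -> : m%:R^-1 * S + w = m%:R^-1 * (S + m%:R * w) by field; rewrite gt_eqF.
rewrite normrM (gtr0_norm (_ : 0 < m%:R^-1)) ?invr_gt0// ler_pdivrMl//.
rewrite [leRHS](_ : _ = 18 * (m%:R * (a * b * l))); last by ring.
by rewrite ler_norml -(ler_pM2l K) -(ler_pM2l K (S + _)) mulrN lo up.
Qed.

(** * Union bound over the exceptional events *)

Section good_event.
Context {R : realType} {d : measure_display} {T : measurableType d}.
Context {P : probability T R} {m n : nat} {sx sw se : R}.
Context {X W : 'I_m -> {RV P >-> 'rV[R]_n}} {e : 'I_m -> {RV P >-> R}}.
Context {bs : 'cV[R]_n} {sz sxi delta L : R}.
Hypothesis setting : additive_error_setting sx sw se X W e.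
Hypothesis bs1 : l2sphere n bs.
Hypotheses (m0 : (0 < m)%N) (n1 : (1 < n)%N) (LE : L = ln n%:R / m%:R).
Hypotheses (szE : sz ^+ 2 = sx ^+ 2 + sw ^+ 2) (sxiE : sxi ^+ 2 = sw ^+ 2 + se ^+ 2).
Hypotheses (sz0 : 0 <= sz) (sxi0 : 0 <= sxi) (delta0 : 0 < delta).
Local Notation xi := (residual bs W e).
Local Notation Z t := (observed_Z X W t).

(** The two sums of squares fail with probability at most [1 / n] each. The [4 * n] cross events,
    taken at level [2 * ln n], fail with probability at most [1 / n^2] each; the total is
    [6 / n]. *)
Lemma bad_event_probability (F : set T) : measurable F ->
  (forall t,
     \sum_i xi i t ^+ 2 <= 4 * m%:R * (sxi ^+ 2 + delta) * (1 / 2 + L) ->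
     \sum_i \sum_j Z t i j ^+ 2 <= 6 * (m%:R * n%:R) * (sz ^+ 2 + delta) ->
     (L < 1 -> 0 < sz * sxi -> forall j,
       `|m%:R^-1 * (\sum_i Z t i j * xi i t) + sw ^+ 2 * bs j 0| <=
       18 * (sz * sxi * Num.sqrt L)) ->
     ~ F t) ->
  (P F <= (6 * expR (- ln n%:R))%:E)%E.
Proof.
move=> mF good.
have mR : 0 < m%:R :> R by rewrite ltr0n.
have nR : 0 < n%:R :> R by rewrite ltr0n ltnW.
have lnn : 0 < ln n%:R :> R by rewrite ln_gt0// ltr1n.
have mL : m%:R * L = ln n%:R by rewrite LE; field; rewrite gt_eqF.
have L0 : 0 < L by rewrite LE divr_gt0.
have V10 : 0 < sxi ^+ 2 + delta by rewrite ltr_wpDl ?sqr_ge0.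
have V20 : 0 < sz ^+ 2 + delta by rewrite ltr_wpDl ?sqr_ge0.
have th4 : `|1 / 4 : R| <= 1 / 4 by rewrite ger0_norm.
pose A1 := [set t | m%:R * (1 / 4) * (sw ^+ 2 + se ^+ 2) +
    (sxi ^+ 2 + delta) * (4 * m%:R * (1 / 4) ^+ 2 + ln n%:R) <
    1 / 4 * \sum_i xi i t ^+ 2].
pose A2 := [set t | (m * n)%:R * (1 / 4) * (sx ^+ 2 + sw ^+ 2) +
    (sz ^+ 2 + delta) * (4 * (m * n)%:R * (1 / 4) ^+ 2 + ln n%:R) <
    1 / 4 * \sum_i \sum_j (X i t 0 j + W i t 0 j) ^+ 2].
(* The first bit selects the sign in the polarisation, the second the side of the tail. *)
pose A3 j (b : bool * bool) := let s : R := (-1) ^+ b.1 in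
  let th : R := (-1) ^+ b.2 * (Num.sqrt L / 4) in
  [set t | m%:R * th * (2 * (sz * sxi) * (sz * sxi - s * (sw ^+ 2 * bs j 0))) +
      4 * (sz * sxi) ^+ 2 * (4 * m%:R * th ^+ 2 + 2 * ln n%:R) <
      th * \sum_i (sxi * Z t i j + s * sz * xi i t) ^+ 2].
(* The tail bound needs [sz * sxi > 0] for a positive variance scale, and [L < 1] keeps [|th|]
   within [1 / 4]. *)
pose guard := (L < 1) && (0 < sz * sxi).
pose A (i : bool + 'I_n * (bool * bool)) : set T := match i with
  | inl true => A1
  | inl false => A2
  | inr (j, b) => if guard then A3 j b else set0
  end.
have mZ i j : measurable_fun setT (fun t => Z t i j).
  exact: (measurableT_comp (measurable_entry i j) (measurable_observed_Z setting)).
have mxi := measurable_residual (bs := bs) setting.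
have entriesE t : \sum_i \sum_j Z t i j ^+ 2 =
    \sum_i \sum_j (X i t 0 j + W i t 0 j) ^+ 2.
  by apply: eq_bigr => i _; apply: eq_bigr => j _; rewrite observed_ZE.
have mA i : measurable (A i).
  case: i => [[]|[j b]] /=.
  - apply: measurable_gt; apply: measurable_funM => //; apply: measurable_sum => i.
    exact: measurable_funX.
  - apply: measurable_gt; apply: measurable_funM => //; apply: measurable_sum => i.
    apply: measurable_sum => j; apply: measurable_funX.
    by have := mZ i j; under eq_fun do rewrite observed_ZE.
  - case: ifP => // _; apply: measurable_gt; apply: measurable_funM => //.
    apply: measurable_sum => i; apply: measurable_funX; apply: measurable_funD.
      exact: measurable_funM.
    exact: measurable_funM.
have FA t : F t -> exists i, A i t.
  move=> Ft; apply: contrapT => /forallNP nA; apply: (good t) => //.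
  - have := nA (inl true); rewrite /= => /negP; rewrite -leNgt -mL.
    have : m%:R * (1 / 4) * (sw ^+ 2 + se ^+ 2) <= m%:R * (1 / 4) * (sxi ^+ 2 + delta).
      by rewrite -sxiE ler_wpM2l ?mulr_ge0 ?lerDl ?ltW.
    by lra.
  - have := nA (inl false); rewrite /= => /negP; rewrite -leNgt.
    rewrite -entriesE.
    have : (m * n)%:R * (1 / 4) * (sx ^+ 2 + sw ^+ 2) <=
        (m * n)%:R * (1 / 4) * (sz ^+ 2 + delta).
      by rewrite -szE ler_wpM2l ?mulr_ge0 ?ler0n// lerDl ltW.
    (* As [ln n <= n <= m * n], the logarithm is absorbed in the number of entries. *)
    have : (sz ^+ 2 + delta) * ln n%:R <= (sz ^+ 2 + delta) * (m * n)%:R.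
      rewrite ler_wpM2l ?(ltW V20)//.
      rewrite (@le_trans _ _ n%:R)//; last by rewrite ler_nat leq_pmull.
      by rewrite ltW// ln_sublinear.
    by rewrite natrM; lra.
  - move=> L1 zx0; have g : guard by rewrite /guard L1 zx0.
    have sz_gt0 : 0 < sz by rewrite lt_neqAle sz0 andbT; apply: contraTneq zx0 => <-; rewrite mul0r ltxx.
    have sxi_gt0 : 0 < sxi by rewrite lt_neqAle sxi0 andbT; apply: contraTneq zx0 => <-; rewrite mulr0 ltxx.
    move=> j; apply: cross_deviation => // s th s2 th2.
    have [b1 sE] : exists b : bool, s = (-1) ^+ b.
      by have /eqP := s2; rewrite sqrf_eq1 => /orP[] /eqP ->; [exists false|exists true].
    have [b2 thE] : exists b : bool, th = (-1) ^+ b * (Num.sqrt L / 4).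
      have /eqP := th2; rewrite eqf_sqr => /orP[] /eqP ->.
        by exists false; rewrite mul1r.
      by exists true; rewrite mulN1r.
    have := nA (inr (j, (b1, b2))); rewrite /= g /A3/= -sE -thE => /negP.
    by rewrite -leNgt mL.
apply: (le_trans (finite_union_bound P _ _ mF mA FA)).
set r := expR (- ln n%:R).
have nr : n%:R * r = 1 by rewrite /r expRN lnK ?posrE// divff// gt_eqF.
have r2 : expR (- (2 * ln n%:R)) = r * r by rewrite -expRD; congr expR; ring.
have pA i : (P (A i) <= (if i is inl _ then r else r * r)%:E)%E.
  case: i => [[]|[j b]] /=.
  - apply: (residual_tail setting bs1) => //; rewrite -sxiE lerDl ltW//.
  - apply: (all_entries_tail setting) => //; first exact: ltnW.
    by rewrite -szE lerDl ltW.
  - case: ifPn => [/andP[L1 zx0]|_]; last by rewrite measure0 lee_fin mulr_ge0 ?expR_ge0.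
    rewrite -r2; apply: (cross_tail setting bs1 szE sxiE zx0).
      by rewrite sqrr_sign.
    rewrite normrM normrX normrN1 expr1n [leLHS]mul1r ger0_norm ?divr_ge0 ?sqrtr_ge0//.
    by rewrite ler_pM2r// -[leRHS]sqrtr1 ler_wsqrtr// ltW.
apply: (le_trans (lee_sum _ (fun i _ => pA i))).
rewrite sumEFin lee_fin big_sumType/= !sumr_const card_bool card_prod card_ord.
rewrite card_prod !card_bool.
have -> : (r * r) *+ (n * (2 * 2)) = 4 * (n%:R * r) * r.
  by rewrite -mulr_natl !natrM; ring.
by rewrite nr -mulr_natl; lra.
Qed.

End good_event.

(** * The minimax upper bound *)

Theorem theorem2 (R : realType) (c1 : R) :
  exists c2 c3 : R, 0 < c2 /\ 0 < c3 /\
  forall q : R, 0 <= q <= 1 ->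
  exists cq : R, 0 < cq /\
  forall (m n : nat) (Rq kappa_l tau_l sigma_x sigma_w sigma_eps : R),
  (1 <= m)%N -> (1 <= n)%N -> 0 < Rq -> 0 < kappa_l ->
  0 <= sigma_x -> 0 <= sigma_w -> 0 <= sigma_eps ->
  tau_l <= c1 * Rq * (ln n%:R / m%:R) `^ (1 - q / 2) ->
  let sigma_z : R := Num.sqrt (sigma_x ^+ 2 + sigma_w ^+ 2) in
  let rho : R := cq *
    ((sigma_z `^ (2 - q) * (sigma_w + sigma_eps) `^ (2 - q)
        + kappa_l `^ (1 - q)) / kappa_l `^ (2 - q)) *
    Rq * (ln n%:R / m%:R) `^ (1 - q / 2) in
  exists beta_hat : 'cV[R]_m * 'M[R]_(m, n) -> 'cV[R]_n,
  measurable_fun setT beta_hat /\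
  forall beta_star : 'cV[R]_n,
  (lq_ball n q Rq `&` l2sphere n) beta_star ->
  forall (d : measure_display) (T : measurableType d) (P : probability T R)
    (X W : 'I_m -> {RV P >-> 'rV[R]_n}) (e : 'I_m -> {RV P >-> R}),
  additive_error_setting sigma_x sigma_w sigma_eps X W e ->
  let Z := observed_Z X W in
  let y := observed_y beta_star X e in
  let failure := [set t | restricted_eigenvalue q (2 * Rq) kappa_l tau_l
                            (Gamma_hat sigma_w (Z t)) /\
                          rho < l2norm (beta_hat (y t, Z t) - beta_star) ^+ 2] in
  (P failure <= (c2 * expR (- c3 * ln n%:R))%:E)%E.
Proof.
exists 6, 1; split=> //; split=> // q q01.
(* The maximum guards against a negative [c1]. *)
set c := Num.max c1 0.
have c0 : 0 <= c by rewrite le_max lexx orbT.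
have K0 : (0 : R) < 10368 by rewrite ltr0n.
have c10 : 0 < 1 + c by rewrite ltr_pwDl.
exists (10368 * (1 + c)); split; first by rewrite mulr_gt0.
move=> m n Rq kappa tau sx sw se m1 n1 Rq0 kappa0 sx0 sw0 se0 tauE sz rho.
set L := ln n%:R / m%:R in tauE rho *.
pose E := Rq * L `^ (1 - q / 2).
pose S := lq_ball n q Rq `&` l2sphere n.
(* If the parameter set is empty, any measurable estimator will do. *)
have [[b0 Sb0]|S0] := pselect (exists b, S b); last first.
  by exists (fun=> 0); split=> // bs Sbs; exfalso; apply: S0; exists bs.
have [u uS] := ex_dense_sequence _ _ Sb0.
(* The tolerance [E] has the order of the rate, so near-minimisation costs only a constant. *)
exists (u \o argmin_index u E); split; first exact: measurable_argmin.
move=> bs Sbs d T P X W e setting.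
pose Z := observed_Z X W; pose y := observed_y bs X e.
pose failure := [set t | restricted_eigenvalue q (2 * Rq) kappa tau
    (Gamma_hat sw (Z t)) /\
  rho < l2norm ((u \o argmin_index u E) (y t, Z t) - bs) ^+ 2].
change (P failure <= (6 * expR (- 1 * ln n%:R))%:E)%E.
have [bsq bs1] := Sbs.
have mfailure : measurable failure.
  have mZ := measurable_observed_Z setting.
  have my := measurable_observed_y (bs := bs) setting.
  apply: measurableI.
    have Rq20 : 0 < 2 * Rq by rewrite mulr_gt0.
    rewrite -[X in measurable X]setTI; exact: (mZ measurableT _ (measurable_restricted_eigenvalue q _ kappa tau sw Rq20)).
  apply: measurable_gt; under eq_fun do rewrite sqr_l2norm.
  apply: measurable_sum => j; apply: measurable_funX.
  under eq_fun do rewrite mxE [X in _ + X]mxE; apply: measurable_funB => //.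
  apply: (measurableT_comp (measurable_entry j 0)).
  apply: (measurableT_comp (measurable_argmin u E)).
  exact: measurable_fun_pair.
(* For [n = 1] the logarithm vanishes and the probability bound 6 is trivial; otherwise [L] and [E]
   are positive. *)
have [n2|n2] := leqP n 1.
  have -> : n = 1%N by apply/eqP; rewrite eqn_leq n2.
  rewrite ln1 mulr0 expR0 mulr1 (le_trans (probability_le1 P mfailure))//.
  by rewrite lee_fin ler1n.
have mR : 0 < m%:R :> R by rewrite ltr0n.
have L0 : 0 < L by rewrite divr_gt0// ln_gt0// ltr1n.
have Rq1 : 1 <= Rq := lq_sphere_radius_ge1 _ _ _ q01 bsq bs1.
have E0 : 0 < E by rewrite mulr_gt0 ?powR_gt0.
pose sxi := Num.sqrt (sw ^+ 2 + se ^+ 2).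
have sz0 : 0 <= sz by exact: sqrtr_ge0.
have sxi0 : 0 <= sxi by exact: sqrtr_ge0.
have szE : sz ^+ 2 = sx ^+ 2 + sw ^+ 2 by rewrite sqr_sqrtr// addr_ge0 ?sqr_ge0.
have sxiE : sxi ^+ 2 = sw ^+ 2 + se ^+ 2 by rewrite sqr_sqrtr// addr_ge0 ?sqr_ge0.
have sxin : sxi <= sw + se.
  rewrite -(@ler_pXn2r _ 2)// ?nnegrE ?addr_ge0// sxiE -subr_ge0.
  by rewrite [leRHS](_ : _ = 2 * (sw * se)); [rewrite !mulr_ge0|ring].
have L10 : 0 < 24 * (L + 1) by rewrite mulr_gt0// addr_gt0.
(* Adding [delta] makes the variance scales positive even for degenerate laws, and it is small
   enough for its contributions to be absorbed in [E]. *)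
pose delta := E / (24 * (L + 1)).
have delta0 : 0 < delta by rewrite divr_gt0.
have deltaE : delta * (24 * (L + 1)) = E by rewrite divfK// gt_eqF.
have tau_le : tau <= c * E.
  rewrite (le_trans tauE)// -mulrA ler_wpM2r ?(ltW E0)//.
  by rewrite le_max lexx.
rewrite mulN1r; apply: (bad_event_probability setting bs1 m1 n2 (erefl L) szE sxiE
  sz0 sxi0 delta0 _ mfailure) => t noise entries dev [RE].
apply/negP; rewrite -leNgt.
have [uA ud] := uS.
set k := argmin_index u E (y t, Z t).
have [bhq bh1] := uA k.
(* Near-minimality among the [u l] passes to [bs] by density and continuity of the loss, with no
   loss of tolerance. *)
have kmin : sqr_loss (y t) (Z t) (u k) <= sqr_loss (y t) (Z t) bs + E.
  apply/ler_addgt0Pr => eps eps0.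
  have [l] := dense_sequence_approx _ _ _ _ _ uS
    (continuous_sqr_loss (y t) (Z t)) Sbs eps0.
  rewrite ltr_distlC => /andP[_ lle].
  have := argmin_indexP u E (y t, Z t) E0 l.
  rewrite -/k /= => /le_trans; apply.
  by rewrite addrAC lerD2r ltW.
apply: (error_bound m1 n1 q01 kappa0 L0 c0 sz0 sxi0 sxin (erefl E) tau_le
  (fun i => observed_yE i t) kmin bsq bs1 bhq bh1 RE deltaE noise entries dev).
  by rewrite ler_nat.
by [].
Qed.
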